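(* Consider $K$ mutually independent restless arms, where arm $i$ ($1\le i\le K$) is a finite-state, irreducible, aperiodic Markov chain with state space $S^i$, transition probability matrix $P^i$ whose multiplicative symmetrization $\hat P^i$ is irreducible, stationary distribution $\boldsymbol\pi^i=\{\pi^i_x\}_{x\in S^i}$, and positive state rewards $r^i_x>0$, $x\in S^i$. Let $\mu^i=\sum_{x\in S^i} r^i_x\pi^i_x$, let $\mu^*=\max_{1\le i\le K}\mu^i$, and assume the arm attaining $\mu^*$ is unique; let $S^*$ be its state space. Let $\pi^i_{\min}=\min_{x\in S^i}\pi^i_x$, $\pi_{\min}=\min_{1\le i\le K}\pi^i_{\min}$, $r_{\max}=\max_{x\in S^i,\,1\le i\le K} r^i_x$, $S_{\max}=\max_{1\le i\le K}|S^i|$, $\hat\pi_{\max}=\max_{x\in S^i,\,1\le i\le K}\{\pi^i_x,\,1-\pi^i_x\}$, $\epsilon_{\min}=\min_{1\le i\le K}\epsilon^i$ where $\epsilon^i$ is the eigenvalue gap of $\hat P^i$, and $M^i_{\max}=\max_{x,y\in S^i,\,x\ne y}M^i_{x,y}$, where $M^i_{x,y}$ is the mean hitting time of state $y$ starting from state $x$ for arm $i$; $M^*_{\max}$ denotes this quantity for the arm attaining $\mu^*$. Suppose the player uses the Regenerative Cycle Algorithm (RCA) with a constant $$L\ \ge\ \frac{112\,S_{\max}^2\,r_{\max}^2\,\hat\pi_{\max}^2}{\epsilon_{\min}}$$ in the index. Then the regret $R^{RCA}(n)$ of RCA satisfies, for every positive integer $n$, $$R^{RCA}(n)\ <\ 4L\ln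 n\sum_{i:\mu^i<\mu^*}\frac{1}{\mu^*-\mu^i}\left(D_i+\frac{E_i}{\mu^*-\mu^i}\right)+\sum_{i:\mu^i<\mu^*}C_i\bigl((\mu^*-\mu^i)D_i+E_i\bigr)+F,$$ where $$C_i=1+\frac{(|S^i|+|S^*|)\,\beta}{\pi_{\min}},\qquad \beta=\sum_{t=1}^\infty t^{-2},\qquad D_i=\frac{1}{\pi^i_{\min}}+M^i_{\max}+1,$$ $$E_i=\mu^i(1+M^i_{\max})+\mu^*M^*_{\max},\qquad F=\mu^*\left(\frac{1}{\pi_{\min}}+\max_{1\le i\le K}M^i_{\max}+1\right).$$
   Context: **Arms and rewards.** There are $K$ arms. Arm $i$ is a discrete-time Markov chain on a finite set $S^i$ (with at least two states) with transition matrix $P^i=(p^i_{xy})_{x,y\in S^i}$; the chains are mutually independent and have arbitrary initial distributions. The arms are restless: at every time slot every chain makes a transition according to its own transition matrix, whether or not it is played and regardless of the player's actions. At each time slot $t=1,2,\dots$ the player plays exactly one arm, observes the current state $x$ of that arm only (say arm $i$), and collects reward $r^i_x$. A superscript $*$ refers to the (unique) arm with the highest mean reward. **Regret.** For a policy $\alpha$, let $\alpha(t)$ be the arm played at time $t$ and $x_\alpha(t)$ the state of arm $\alpha(t)$ at time $t$. The regret up to time $n$ is $$R^\alpha(n)=n\mu^*-E^\alpha\left[\sum_{t=1}^n r^{\alpha(t)}_{x_\alpha(t)}\right],$$ where $E^\alpha$ is expectation under policy $\alpha$. **Multiplicative symmetrization and eigenvalue gap.** The adjoint $(P^i)'$ of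 $P^i$ on $l_2(\pi^i)$ has entries $(p^i)'_{xy}=\pi^i_y p^i_{yx}/\pi^i_x$. The multiplicative symmetrization is $\hat P^i=(P^i)'P^i$. Its eigenvalue gap is $\epsilon^i=1-\lambda_2$, where $\lambda_2$ is the second largest eigenvalue of $\hat P^i$. **Regenerative Cycle Algorithm (RCA).** RCA operates in successive blocks $b=1,2,\dots$; within a block the same arm is played in every time slot, and consecutive blocks occupy consecutive time slots. - Initial blocks. For $b=1,\dots,K$, arm $b$ is played in block $b$. The first state observed in block $b$ is designated as $\gamma^b$, the regenerative state of arm $b$, fixed from then on. The block continues until $\gamma^b$ is observed a second time; that slot is the last one of the block. - Later blocks. For $b>K$, let $i$ be the arm with the largest index at the end of block $b-1$ (ties broken arbitrarily). Arm $i$ is played until $\gamma^i$ is observed for the first time in the block, and then is played further until $\gamma^i$ is observed for the second time in the block; the slot of this second observation is the last one of the block. - Sub-blocks. Each block in which arm $i$ is played is divided into three parts: SB1 consists of the slots from the beginning of the block to right before the first visit to $\gamma^i$ (possibly empty, and empty for the first $K$ blocks); SB2 consists of the slots from the first visit to $\gamma^i$ (included) up to but excluding the second visit to $\gamma^i$; SB3 is the single slot of the second visit to $\gamma^i$. - Index. At the end of each block $b\ge K$, let $t_2=t_2(b)$ be the total number of slots spent in SB2's (over all arms) in blocks $1,\dots,b$, and let $T^i_2$ be the number of those slots in which arm $i$ was played. Let $\bar r^i$ be the average of the $T^i_2$ rewards obtained from arm $i$ during these SB2 slots. The index of arm $i$ is $$g^i=\bar r^i+\sqrt{\frac{L\ln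 t_2}{T^i_2}},$$ where $L$ is a constant parameter of the algorithm. Rewards are collected in all slots (SB1, SB2 and SB3) and all count in the regret; only SB2 rewards are used in the indices. *)

(* Defs.v *)
From HB Require Import structures.
From mathcomp Require Import all_boot all_order all_algebra.
From mathcomp Require Import all_classical all_reals all_analysis.

Set Implicit Arguments.
Unset Strict Implicit.
Unset Printing Implicit Defensive.

Import Order.TTheory GRing.Theory Num.Theory numFieldNormedType.Exports.

Local Open Scope classical_set_scope.
Local Open Scope ring_scope.

Section Chain.
Variables (R : realType) (m : nat).
Implicit Types (P : 'M[R]_m) (p : 'I_m -> R).

Definition stochastic P :=
  (forall x y, 0 <= P x y) /\ (forall x, \sum_y P x y = 1).

Definition irreducible P := forall x y, exists n : nat, 0 < (P ^+ n) x y.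

(* The period of x is the gcd of its possible return times; [d] ranges over
   the common divisors of these. *)
Definition aperiodic P :=
  forall (x : 'I_m) (d : nat),
    (forall n : nat, (0 < n)%N -> 0 < (P ^+ n) x x -> (d %| n)%N) -> d = 1%N.

Definition stationary P p :=
  [/\ forall x, 0 <= p x, \sum_x p x = 1
    & forall y, \sum_x p x * P x y = p y].

Definition adjoint P p : 'M[R]_m := \matrix_(x, y) (p y * P y x / p x).

Definition mult_symm P p : 'M[R]_m := adjoint P p *m P.

(* Eigenvalues in non-increasing order, repeated according to algebraic
   multiplicity; [::] when the characteristic polynomial does not split over R
   (which never happens for [mult_symm P p], self-adjoint in l2(p)). *)
Definition spectrum (A : 'M[R]_m) : seq R :=
  xget [::] [set s : seq R | sorted >=%R s /\
                             char_poly A = \prod_(z <- s) ('X - z%:P)].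

Definition eigen_gap (A : 'M[R]_m) : R := 1 - nth 0 (spectrum A) 1.

Fixpoint path_prob P (x : 'I_m) (s : seq 'I_m) : R :=
  if s is y :: s' then P x y * path_prob P y s' else 1.

(* P_x(X_1 <> y, ..., X_t <> y, X_{t+1} = y): the path s = (X_1, ..., X_{t+1})
   meets y for the first time in its last entry. *)
Definition first_hit_prob P (x y : 'I_m) (t : nat) : R :=
  \sum_(s : t.+1.-tuple 'I_m | index y s == t) path_prob P x s.

(* Mean of the first time t >= 1 with X_t = y, given X_0 = x (used for x <> y). *)
Definition mean_hit P (x y : 'I_m) : R :=
  limn (series (fun t : nat => t.+1%:R * first_hit_prob P x y t)).

Definition max_hit P : R :=
  \big[Num.max/0]_x \big[Num.max/0]_(y | y != x) mean_hit P x y.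

(* The initial value 1 is neutral: p takes values in [0, 1]. *)
Definition min_prob p : R := \big[Num.min/1]_x p x.

End Chain.

Section Process.
Context (R : realType) (d : measure_display) (T : measurableType d).
Variable Pr : probability T R.

(* X t is the state in slot t + 1; the law of X 0 is arbitrary. *)
Definition markov_chain (m : nat) (P : 'M[R]_m) (X : nat -> T -> 'I_m) :=
  (forall t x, measurable [set w | X t w = x]) /\
  (forall (t : nat) (h : nat -> 'I_m) (y : 'I_m),
     Pr [set w | (forall s, (s <= t)%N -> X s w = h s) /\ X t.+1 w = y] =
     (Pr [set w | forall s, (s <= t)%N -> X s w = h s] * (P (h t) y)%:E)%E).

Definition salgebra_of (J E : Type) (Y : J -> T -> E) : set (set T) :=
  <<s [set A | exists j e, A = [set w | Y j w = e]] >>.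

(* The product rule for subfamilies is the case A i = setT for the other i. *)
Definition mutually_independent (I : finType) (F : I -> set (set T)) :=
  forall A : I -> set T, (forall i, F i (A i)) ->
    Pr (\bigcap_i A i) = (\prod_i Pr (A i))%E.

End Process.

Section Bandit.
Context (R : realType) (K : nat) (N : 'I_K -> nat).

(* What the player has seen: the arms played so far, each with the state
   observed, in chronological order. *)
Definition history := seq {i : 'I_K & 'I_(N i)}.

Definition policy := history -> 'I_K.

Variable r : forall i, 'I_(N i) -> R.

Fixpoint play (a : policy) (x : forall i, nat -> 'I_(N i)) (t : nat) : history :=
  if t is t'.+1 then
    let h := play a x t' in rcons h (Tagged (fun i => 'I_(N i)) (x (a h) t'))
  else [::].

Definition total_reward (a : policy) (x : forall i, nat -> 'I_(N i)) (n : nat) : R :=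
  \sum_(t < n) let i := a (play a x t) in r (x i t).

(* Position after a slot: between two blocks; in a block of the given arm
   whose regenerative state has not been seen yet in the block (SB1); after the
   first, but before the second, visit to it in the block (SB2). *)
Inductive phase := Between | Before of 'I_K | Within of 'I_K.

Record rca_state := RcaState {
  ph : phase;
  nblocks : nat;                         (* number of completed blocks *)
  regen : forall i, option 'I_(N i);     (* None: arm not yet observed *)
  slots2 : 'I_K -> nat;                  (* T_2^i *)
  rewards2 : 'I_K -> R                   (* rewards of arm i in SB2 slots *)
}.

Definition rca_init :=
  RcaState Between 0 (fun=> None) (fun=> 0%N) (fun=> 0).

Definition rca_step (s : rca_state) (o : {i : 'I_K & 'I_(N i)}) : rca_state :=
  let i := tag o in
  let x := tagged o in
  (* the first state ever observed from arm i becomes its regenerative state *)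
  let visit := if regen s i is Some g then x == g else true in
  let T2 := fun j => (slots2 s j + (j == i))%N in
  let r2 := fun j => rewards2 s j + (if j == i then r x else 0) in
  match ph s, visit with
  | Within _, true =>
      RcaState Between (nblocks s).+1 (regen s) (slots2 s) (rewards2 s)
  | Within _, false =>
      RcaState (Within i) (nblocks s) (regen s) T2 r2
  | _, true =>
      RcaState (Within i) (nblocks s) (dfwith (regen s) i (Some x)) T2 r2
  | _, false =>
      RcaState (Before i) (nblocks s) (regen s) (slots2 s) (rewards2 s)
  end.

Definition rca_run (h : history) : rca_state := foldl rca_step rca_init h.

Definition rca_index (L : R) (s : rca_state) (i : 'I_K) : R :=
  let t2 := (\sum_j slots2 s j)%N in
  rewards2 s i / (slots2 s i)%:R
  + Num.sqrt (L * ln (t2%:R) / (slots2 s i)%:R).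

(* Arms are numbered from 0. The choice between several arms of maximal index
   is left to the policy, and may depend on the whole history. *)
Definition is_rca (L : R) (a : policy) :=
  forall h : history,
    let s := rca_run h in
    match ph s with
    | Before i | Within i => a h = i
    | Between =>
        if (nblocks s < K)%N then a h = nblocks s :> nat
        else forall j, rca_index L s j <= rca_index L s (a h)
    end.

Context (d : measure_display) (T : measurableType d).
Variable Pr : probability T R.

(* The sigma-algebras of the arms (Some i) and of the player's policy (None).
   The policy is random only through a possible randomization of ties. *)
Definition sources (X : forall i, nat -> T -> 'I_(N i)) (alpha : T -> policy)
    (o : option 'I_K) : set (set T) :=
  if o is Some i then salgebra_of (X i)
  else salgebra_of (fun (h : history) w => alpha w h).

Definition regret (mu : R) (X : forall i, nat -> T -> 'I_(N i))
    (alpha : T -> policy) (n : nat) : \bar R :=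
  ((n%:R * mu)%:E
   - 'E_Pr[fun w => total_reward (alpha w) (fun i t => X i t w) n])%E.

End Bandit.

Section Bound.
Context (R : realType) (K : nat) (N : 'I_K -> nat).
Variables (P : forall i, 'M[R]_(N i)) (p r : forall i, 'I_(N i) -> R).

Definition mean_reward (i : 'I_K) : R := \sum_x r x * p (i := i) x.

Definition S_max : nat := \max_i N i.

(* rewards are positive *)
Definition r_max : R := \big[Num.max/0]_i \big[Num.max/0]_x r (i := i) x.

Definition p_min : R := \big[Num.min/1]_i min_prob (p (i := i)).

Definition phat_max : R :=
  \big[Num.max/0]_i \big[Num.max/0]_x Num.max (p (i := i) x) (1 - p x).

Definition arm_gap (i : 'I_K) : R := eigen_gap (mult_symm (P i) (p (i := i))).

(* The initial value 1 is neutral: the symmetrizations are positive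
   semidefinite on l2(p), so that the gaps are at most 1. *)
Definition gap_min : R := \big[Num.min/1]_i arm_gap i.

Definition hit_max : R := \big[Num.max/0]_i max_hit (P i).

Definition beta : R := limn (series (fun t : nat => (t.+1%:R : R) ^- 2)).

(* In C_, E_ and F_, [s] is the arm with the highest mean reward. *)
Definition C_ (s i : 'I_K) : R := 1 + (N i + N s)%:R * beta / p_min.

Definition D_ (i : 'I_K) : R := (min_prob (p (i := i)))^-1 + max_hit (P i) + 1.

Definition E_ (s i : 'I_K) : R :=
  mean_reward i * (1 + max_hit (P i)) + mean_reward s * max_hit (P s).

Definition F_ (s : 'I_K) : R := mean_reward s * (p_min^-1 + hit_max + 1).

Definition regret_bound (L : R) (s : 'I_K) (n : nat) : R :=
  let mu := mean_reward in
  4 * L * ln (n%:R)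
    * (\sum_(i | mu i < mu s)
         (mu s - mu i)^-1 * (D_ i + E_ s i / (mu s - mu i)))
  + \sum_(i | mu i < mu s) C_ s i * ((mu s - mu i) * D_ i + E_ s i)
  + F_ s.

End Bound.

(* Main.v *)
Require Import Defs.
From HB Require Import structures.
From mathcomp Require Import all_boot all_order all_algebra.
From mathcomp Require Import all_classical all_reals all_analysis.
From mathcomp Require Import ring lra zify.
From mathcomp Require complex.

Set Implicit Arguments.
Unset Strict Implicit.
Unset Printing Implicit Defensive.

Import Order.TTheory GRing.Theory Num.Theory numFieldNormedType.Exports.
Local Open Scope classical_set_scope.
Local Open Scope ring_scope.

(** The regret is at most a constant plus, for every suboptimal arm, the cost of
    one of its blocks times the number of its blocks; the cost comes from a
    potential function, the number from large deviations of sample means.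

    Cost of a block. In an irreducible chain with stationary law [p], the mean
    time [h_z x] to hit [z] from [x] (with [h_z z = 0]) satisfies
    [P h_z = h_z - 1 + 1_z / p z], by first-step analysis and, at [z], by Kac's
    formula ([hit_time_step]). Hence [gam = \sum_z r z p z h_z] solves the
    Poisson equation [P gam = gam - mu + r] and lies between [0] and
    [mu * max_hit] ([poisson_solution]). A run of consecutive plays of an arm,
    ended at any random time, thus loses against [mu] per slot at most the value
    of [gam] at its first state. Since this needs no renewal at the end of the
    run, the block that the horizon cuts is treated like the others.
    [regret_potential] is this [gam] for the arm being played, plus, in a block
    of a suboptimal arm, the gap of the arm times the mean remaining length of
    the block and a reserve that pays for the next run of the best arm. It is a
    supermartingale up to a payment [block_cost i] at the start of each block of
    [i] ([regret_potential_drift]), whence [regret_le_blocks].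

    Number of blocks. Once arm [i] has [4 L ln n / gap^2] samples, its confidence
    radius is at most half its gap, so it can be selected only if its sample mean
    or that of the best arm is off by its radius ([selected_excess]). Every block
    adds at least one sample, so the total number [t] of samples differs from one
    selection to the next, and each value of [t] can be charged at most once
    ([block_count_le]). A union bound over the sample sizes [w <= t] remains.

    Deviations. Each SB2 period goes from the regenerative state up to, but
    excluding, its next visit, so the concatenated SB2 periods of an arm form a
    path of its chain; [sample_potential] expresses this without leaving the
    actual time scale, on which the other arms are played in between. Exponential
    moments along such a path are controlled by the norm in [l2(p)] of the kernel
    tilted by [D = exp(theta f)]: as [|P u|^2 = <u, P'P u>], the gap [eps] of the
    multiplicative symmetrization gives
    [|P D u|^2 <= (1 - eps) |D u|^2 + eps <D u, 1>^2], and a Cauchy-Schwarz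
    inequality with a suitable weight bounds the right side by [e^kappa |u|^2]
    with [kappa] of order [theta^2 / eps] ([mgf_chernoff]). The probability that
    [w] samples deviate in mean by [g] is then at most
    [2 / p_min * exp (- g^2 eps w / 20)]. At the confidence radius the lower bound
    on [L] makes this smaller than [2 / p_min * t^-3], summable after the union
    bound.

    Probability. All of this needs only [slot_mean_step]: given the past, the arm
    that has just been played moves by its own kernel, although the player sees
    it at irregular times. *)

(** * Real symmetric matrices *)

Section RealSymmetric.
Import complex.
Variable R : rcfType.
Local Notation toC := (real_complex R).
Local Notation cmx := (map_mx toC).

(** Complex matrices are handled through their real and imaginary parts, so that
    the complex spectral theorem yields a statement about real matrices. *)
Lemma cmx_rect_inj m n (A B A' B' : 'M[R]_(m, n)) :
  cmx A + 'i%C *: cmx B = cmx A' + 'i%C *: cmx B' -> A = A' /\ B = B'.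
Proof.
move=> E; split; apply/matrixP => i j; move/matrixP: E => /(_ i j);
  rewrite !mxE; simpc => -[]; rewrite ?(addr0, add0r, mul0r, mul1r, oppr0) //.
Qed.

Lemma cmx_rect m n (U : 'M[R[i]]_(m, n)) :
  U = cmx (map_mx (@Re R) U) + 'i%C *: cmx (map_mx (@Im R) U).
Proof. by apply/matrixP => i j; rewrite !mxE; case: (U i j) => a b; simpc. Qed.

Lemma cmx_rect_adj m n (V W : 'M[R]_(m, n)) :
  (map_mx Num.conj (cmx V + 'i%C *: cmx W)^T) = cmx V^T + 'i%C *: cmx (- W^T).
Proof.
apply/matrixP => i j; rewrite !mxE.
rewrite -[Num.conj]/(@conjc R); simpc. by [].
Qed.

Lemma char_poly_similar (F : comUnitRingType) m (U A B : 'M[F]_m) :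
  U \in unitmx -> U *m A = B *m U -> char_poly A = char_poly B.
Proof.
move=> uU UA; rewrite /char_poly.
have EA : map_mx polyC U *m char_poly_mx A = char_poly_mx B *m map_mx polyC U.
  by rewrite /char_poly_mx mulmxBr mulmxBl -!map_mxM UA scalar_mxC.
have := congr1 (fun M => \det (map_mx polyC (invmx U) *m M)) EA.
by rewrite !mulmxA -map_mxM mulVmx // map_mx1 mul1mx !det_mulmx mulrAC
  -det_mulmx -map_mxM mulVmx // map_mx1 det1 mul1r.
Qed.

Lemma cmx1 m : cmx 1%:M + 'i%C *: cmx 0 = 1%:M :> 'M[R[i]]_m.
Proof. by rewrite map_mx1 map_mx0 scaler0 addr0. Qed.

Lemma cmx_rect_mul m n k (A B : 'M[R]_(m, n)) (C D : 'M[R]_(n, k)) :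
  (cmx A + 'i%C *: cmx B) *m (cmx C + 'i%C *: cmx D) =
  cmx (A *m C - B *m D) + 'i%C *: cmx (A *m D + B *m C).
Proof.
have i2 : 'i%C * 'i%C = -1 :> R[i] by rewrite -expr2 sqr_i.
rewrite mulmxDl !mulmxDr -!scalemxAr -!scalemxAl -!map_mxM scalerA i2 scaleN1r.
by rewrite map_mxB map_mxD scalerDr addrACA [_ - _ + _]addrC [X in _ + X]addrC addrA addrAC [X in X + _]addrC; rewrite -!addrA; congr (_ + _); rewrite addrCA.
Qed.

(** [V] and [W] are the real and imaginary parts of a unitary matrix that
    diagonalizes [A]; keeping both avoids choosing real eigenvectors, and the sum
    of the squares of the two coordinates plays the role of one squared
    coordinate. *)
Lemma real_symmetric_spectral m (A : 'M[R]_m) : A^T = A ->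
  exists (l : 'rV[R]_m) (V W : 'M[R]_m),
  [/\ char_poly A = \prod_j ('X - (l 0 j)%:P),
      V *m A = diag_mx l *m V /\ W *m A = diag_mx l *m W,
      V^T *m V + W^T *m W = 1%:M,
      V *m V^T + W *m W^T = 1%:M & W *m V^T = V *m W^T].
Proof.
move=> symA; pose AC := cmx A.
have hermA : AC \is hermsymmx.
  apply/is_hermitianmxP; rewrite expr0 scale1r.
  apply/matrixP => i j; rewrite !mxE -[in LHS]symA mxE.
  by rewrite -[Num.conj]/(@conjc R) conjc_real.
have /hermitian_normalmx /orthomx_spectralP := hermA.
have /mxOverP := hermitian_spectral_diag_real hermA.
have := spectral_unitarymx AC; have := spectral_unit AC.
set U := spectralmx AC; set D := spectral_diag AC.
move=> uU unU realD EA.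
pose l : 'rV[R]_m := map_mx (@Re R) D.
have ED : D = cmx l by apply/matrixP => i j; rewrite !mxE RRe_real.
pose V := map_mx (@Re R) U; pose W := map_mx (@Im R) U.
have EU : U = cmx V + 'i%C *: cmx W by exact: cmx_rect.
have EUs : invmx U = cmx V^T + 'i%C *: cmx (- W^T).
  by rewrite invmx_unitary // {1}EU cmx_rect_adj.
exists l, V, W; split.
- apply: (map_poly_inj toC).
  rewrite map_char_poly -/AC.
  have -> : char_poly AC = char_poly (diag_mx (cmx l)).
    apply: (char_poly_similar uU).
    by rewrite -ED {1}EA !mulmxA mulmxV // mul1mx.
  rewrite char_poly_trig ?diag_mx_is_trig // rmorph_prod /=.
  apply: eq_bigr => j _.
  by rewrite rmorphB /= map_polyX map_polyC /= !mxE eqxx mulr1n.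
- have : U *m AC = cmx (diag_mx l) *m U.
    by rewrite map_diag_mx -ED EA !mulmxA mulmxV // mul1mx.
  rewrite EU mulmxDl mulmxDr -scalemxAl -scalemxAr -!map_mxM /=.
  by move=> /cmx_rect_inj.
- have : invmx U *m U = 1%:M by rewrite mulVmx.
  rewrite EUs EU cmx_rect_mul -cmx1 => /cmx_rect_inj [E _].
  by rewrite mulNmx opprK in E.
- have : U *m invmx U = 1%:M by rewrite mulmxV.
  rewrite EUs EU cmx_rect_mul -cmx1 => /cmx_rect_inj [E _].
  by rewrite mulmxN opprK in E.
- have : U *m invmx U = 1%:M by rewrite mulmxV.
  rewrite EUs EU cmx_rect_mul -cmx1 => /cmx_rect_inj [_ E].
  by apply/eqP; rewrite -subr_eq0 -E mulmxN addrC.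
Qed.

(** The same decomposition in coordinates, with the Parseval identity and the
    diagonal form of the quadratic form of [A]. *)
Lemma real_symmetric_eigenbasis m (A : 'M[R]_m) : A^T = A ->
  exists (l : 'I_m -> R) (V W : 'I_m -> 'I_m -> R),
  [/\ char_poly A = \prod_j ('X - (l j)%:P),
      forall j x, \sum_y V j y * A y x = l j * V j x /\
                  \sum_y W j y * A y x = l j * W j x,
      forall j k, \sum_x (V j x * V k x + W j x * W k x) = (j == k)%:R /\
                  \sum_x (W j x * V k x) = \sum_x (V j x * W k x),
      forall v : 'I_m -> R, \sum_x v x ^+ 2 =
        \sum_j ((\sum_x V j x * v x) ^+ 2 + (\sum_x W j x * v x) ^+ 2) &
      forall v : 'I_m -> R, \sum_x v x * (\sum_y A x y * v y) =
        \sum_j l j * ((\sum_x V j x * v x) ^+ 2 + (\sum_x W j x * v x) ^+ 2)].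
Proof.
move=> /real_symmetric_spectral [l [V [W [chA [VA WA] VV VVt VWt]]]].
exists (l 0), V, W.
have entry (M N : 'M[R]_m) (u v : 'I_m -> R) :
  \sum_x u x * (\sum_y (M^T *m N) x y * v y) =
  \sum_j (\sum_x M j x * u x) * (\sum_y N j y * v y).
  transitivity (\sum_x \sum_y \sum_j (M j x * u x) * (N j y * v y)).
    apply: eq_bigr => x _; rewrite big_distrr; apply: eq_bigr => y _ /=.
    rewrite mxE mulr_suml mulr_sumr; apply: eq_bigr => j _; rewrite mxE; ring.
  under eq_bigr do rewrite exchange_big.
  rewrite exchange_big; apply: eq_bigr => j _ /=.
  by rewrite mulr_suml; apply: eq_bigr => x _; rewrite mulr_sumr.
have dl (M : 'M[R]_m) j x : (diag_mx l *m M) j x = l 0 j * M j x.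
  by rewrite mul_diag_mx mxE.
split=> //.
- move=> j x; move/matrixP: VA => /(_ j x); move/matrixP: WA => /(_ j x).
  by rewrite !dl !mxE.
- move=> j k; split.
    move/matrixP: VVt => /(_ j k); rewrite !mxE => <-; rewrite big_split /=.
    by congr (_ + _); apply: eq_bigr => x _; rewrite mxE.
  move/matrixP: VWt => /(_ j k); rewrite !mxE => E.
  transitivity (\sum_x W j x * V^T x k); first by apply: eq_bigr => x _; rewrite mxE.
  by rewrite E; apply: eq_bigr => x _; rewrite mxE.
- move=> v.
  transitivity (\sum_x v x * (\sum_y (V^T *m V + W^T *m W) x y * v y)).
    apply: eq_bigr => x _; rewrite VV (bigD1 x) //= !mxE eqxx big1 => [|y yx].
      by rewrite addr0 mul1r expr2.
    by rewrite mxE eq_sym (negPf yx) mul0r.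
  under eq_bigr do under eq_bigr do rewrite mxE mulrDl.
  under eq_bigr do rewrite big_split mulrDr /=.
  by rewrite big_split /= !entry -big_split /=; apply: eq_bigr => j _; rewrite !expr2.
- move=> v.
  transitivity (\sum_x v x * (\sum_y (V^T *m (diag_mx l *m V) + W^T *m (diag_mx l *m W)) x y * v y)).
    apply: eq_bigr => x _; congr (_ * _); apply: eq_bigr => y _.
    by rewrite -VA -WA !mulmxA -mulmxDl VV mul1mx.
  under eq_bigr do under eq_bigr do rewrite mxE mulrDl.
  under eq_bigr do rewrite big_split mulrDr /=.
  rewrite big_split /= !entry -big_split /=; apply: eq_bigr => j _.
  under [in X in _ * X + _]eq_bigr do rewrite dl -mulrA.
  under [in X in _ + _ * X]eq_bigr do rewrite dl -mulrA.
  by rewrite -!mulr_sumr; ring.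
Qed.

End RealSymmetric.

(** * Spectral gap of a reversible chain *)

Section Spectrum.
Variable R : realType.

(** The sorted list of roots exists as soon as the characteristic polynomial
    splits, and unique factorization makes it a permutation of any other list of
    roots. *)
Lemma spectrumP m (A : 'M[R]_m) (s : seq R) :
  char_poly A = \prod_(z <- s) ('X - z%:P) ->
  sorted >=%R (spectrum A) /\ perm_eq (spectrum A) s.
Proof.
move=> chA.
have [|sortA chsA] := @xgetPex _ [::] [set s : seq R | sorted >=%R s /\
                             char_poly A = \prod_(z <- s) ('X - z%:P)].
  exists (sort >=%R s); split; first by apply: sort_sorted => x y; exact: le_total.
  by rewrite chA; apply: perm_big; rewrite perm_sym perm_sort.
split=> //.
by apply: prod_XsubC_eq; rewrite -chA.
Qed.
End Spectrum.

Section Gap.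
Variables (R : realType) (m : nat) (Q : 'M[R]_m) (p : 'I_m -> R).
Hypotheses (m_gt1 : (1 < m)%N) (p_gt0 : forall x, 0 < p x) (p_sum : \sum_x p x = 1).
Hypotheses (Qst : stochastic Q) (Qirr : irreducible Q).
Hypothesis rev : forall x y, p x * Q x y = p y * Q y x.

Let Q_ge0 x y : 0 <= Q x y. Proof. by case: Qst. Qed.
Let Q_sum x : \sum_y Q x y = 1. Proof. by case: Qst. Qed.
Let p_ge0 x : 0 <= p x. Proof. exact: ltW. Qed.

Let Qstat y : \sum_x p x * Q x y = p y.
Proof. by under eq_bigr do rewrite rev; rewrite -mulr_sumr Q_sum mulr1. Qed.

(** The Dirichlet form: it shows that [Q] is a contraction, and that equality in
    the contraction propagates along the edges of [Q]. *)
Lemma dirichlet_form (u : 'I_m -> R) :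
  \sum_x p x * u x ^+ 2 - \sum_x p x * u x * (\sum_y Q x y * u y) =
  2^-1 * \sum_x \sum_y p x * Q x y * (u x - u y) ^+ 2.
Proof.
have E : \sum_x \sum_y p x * Q x y * (u x - u y) ^+ 2 =
  \sum_x \sum_y p x * Q x y * u x ^+ 2 + \sum_x \sum_y p x * Q x y * u y ^+ 2
   - 2 * \sum_x \sum_y p x * u x * (Q x y * u y).
  rewrite mulr_sumr -big_split /= -sumrB; apply: eq_bigr => x _.
  rewrite mulr_sumr -big_split /= -sumrB; apply: eq_bigr => y _; ring.
rewrite E.
have -> : \sum_x \sum_y p x * Q x y * u x ^+ 2 = \sum_x p x * u x ^+ 2.
  by apply: eq_bigr => x _; rewrite -mulr_suml -mulr_sumr Q_sum mulr1.
have -> : \sum_x \sum_y p x * Q x y * u y ^+ 2 = \sum_x p x * u x ^+ 2.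
  rewrite exchange_big; apply: eq_bigr => x _ /=; rewrite -mulr_suml.
  by rewrite Qstat.
have -> : \sum_x \sum_y p x * u x * (Q x y * u y) = \sum_x p x * u x * (\sum_y Q x y * u y).
  by apply: eq_bigr => x _; rewrite mulr_sumr.
lra.
Qed.

Lemma dirichlet_form_const (u : 'I_m -> R) :
  \sum_x p x * u x ^+ 2 <= \sum_x p x * u x * (\sum_y Q x y * u y) ->
  forall x y, u x = u y.
Proof.
rewrite -subr_le0 dirichlet_form pmulr_rle0 ?invr_gt0 // => le0.
have term_ge0 x y : 0 <= p x * Q x y * (u x - u y) ^+ 2.
  exact: mulr_ge0 (mulr_ge0 (p_ge0 _) (Q_ge0 _ _)) (sqr_ge0 _).
have {}le0 : \sum_x \sum_y p x * Q x y * (u x - u y) ^+ 2 = 0.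
  by apply/eqP; rewrite eq_le le0; apply: sumr_ge0 => x _; apply: sumr_ge0.
have edge x y : 0 < Q x y -> u x = u y.
  move=> Qxy; move/eqP: le0; rewrite psumr_eq0; last by move=> ? _; apply: sumr_ge0.
  move=> /allP /(_ x); rewrite mem_index_enum /= psumr_eq0 // => /(_ isT) /allP /(_ y).
  rewrite mem_index_enum => /(_ isT) /=.
  by rewrite mulf_eq0 sqrf_eq0 subr_eq0 mulf_eq0 (gt_eqF (p_gt0 x)) (gt_eqF Qxy) => /eqP.
have path k : forall x y, 0 < (Q ^+ k) x y -> u x = u y.
  elim: k => [|k IH] x y.
    by rewrite expr0 mxE; case: eqP => [->|]//; rewrite ltxx.
  rewrite exprS mxE => pos.
  have [z /andP[xz zy]] : exists z, (0 < Q x z) && (0 < (Q ^+ k) z y).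
    apply/existsP; apply: contraPT pos => /existsPn none.
    apply/negP; rewrite -leNgt sumr_le0 // => z _.
    have := none z; rewrite negb_and -!leNgt => /orP[] z0.
      by have -> : Q x z = 0; [apply/eqP; rewrite eq_le z0 Q_ge0 | rewrite mul0r].
    by rewrite mulr_ge0_le0 // Q_ge0.
  by rewrite (edge _ _ xz) (IH _ _ zy).
by move=> x y; have [k] := Qirr x y; apply: path.
Qed.

(** Conjugation by the square root of [p] turns [Q] into a symmetric matrix [A]
    with the same characteristic polynomial, for which the square root of [p] is
    an eigenvector of eigenvalue 1. All eigenvalues are at most 1 by the Dirichlet
    form, and 1 is simple since by irreducibility only multiples of the square
    root of [p] are fixed by [A]; so the second entry of the spectrum bounds every
    eigenvalue but that one. *)
Lemma spectral_gap : let l2 := nth 0 (spectrum Q) 1 in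
  l2 < 1 /\ forall u, \sum_x p x * u x * (\sum_y Q x y * u y) <=
    l2 * (\sum_x p x * u x ^+ 2) + (1 - l2) * (\sum_x p x * u x) ^+ 2.
Proof.
pose s x := Num.sqrt (p x).
have s_gt0 x : 0 < s x by rewrite sqrtr_gt0.
have s_neq0 x : s x != 0 by rewrite gt_eqF.
have ss x : s x * s x = p x by rewrite -expr2 sqr_sqrtr // ltW.
pose A : 'M[R]_m := \matrix_(x, y) (s x * Q x y / s y).
have symA : A^T = A.
  apply/matrixP => x y; rewrite !mxE.
  by apply/eqP; rewrite eqr_div // mulrAC ss [X in _ == X]mulrAC ss rev.
have [l [V [W [chA eigA orth normA qformA]]]] := real_symmetric_eigenbasis symA.
pose w v j := (\sum_x V j x * v x) ^+ 2 + (\sum_x W j x * v x) ^+ 2.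
have w_ge0 v j : 0 <= w v j by rewrite addr_ge0 // sqr_ge0.
have {}normA v : \sum_x v x ^+ 2 = \sum_j w v j by exact: normA.
have {}qformA v : \sum_x v x * (\sum_y A x y * v y) = \sum_j l j * w v j.
  exact: qformA.
have chQ : char_poly Q = \prod_(z <- [seq l j | j <- enum 'I_m]) ('X - z%:P).
  rewrite big_map big_enum -chA /=.
  apply: (@char_poly_similar _ _ (diag_mx (\row_x s x))).
    by rewrite unitmxE det_diag unitfE; apply/prodf_neq0 => x _; rewrite mxE.
  by apply/matrixP => x y; rewrite mul_diag_mx mul_mx_diag !mxE divfK.
have [sortS permS] := spectrumP chQ.
have norm_s (u : 'I_m -> R) : \sum_x (s x * u x) ^+ 2 = \sum_x p x * u x ^+ 2.
  by apply: eq_bigr => x _; rewrite exprMn expr2 ss.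
have energy_s (u : 'I_m -> R) : \sum_x (s x * u x) * (\sum_y A x y * (s y * u y)) =
   \sum_x p x * u x * (\sum_y Q x y * u y).
  apply: eq_bigr => x _; rewrite -ss.
  have -> : \sum_y A x y * (s y * u y) = s x * \sum_y Q x y * u y.
    rewrite mulr_sumr; apply: eq_bigr => y _; rewrite mxE.
    by rewrite mulrA divfK // mulrA.
  ring.
have s_div (v : 'I_m -> R) : v = (fun x => s x * (v x / s x)).
  by apply/funext => x; rewrite mulrC divfK.
have contr (v : 'I_m -> R) : \sum_x v x * (\sum_y A x y * v y) <= \sum_x v x ^+ 2.
  rewrite (s_div v) norm_s energy_s -subr_ge0 dirichlet_form mulr_ge0 ?invr_ge0 //.
  apply: sumr_ge0 => x _; apply: sumr_ge0 => y _.
  exact: mulr_ge0 (mulr_ge0 (p_ge0 _) (Q_ge0 _ _)) (sqr_ge0 _).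
have eqcase (v : 'I_m -> R) : \sum_x v x * (\sum_y A x y * v y) = \sum_x v x ^+ 2 ->
    exists c, forall x, v x = c * s x.
  move=> E; exists (v (Ordinal m_gt1) / s (Ordinal m_gt1)) => x.
  suff <- : v x / s x = v (Ordinal m_gt1) / s (Ordinal m_gt1) by rewrite divfK.
  apply: (@dirichlet_form_const (fun x => v x / s x)).
  by move: (E); rewrite [in X in X -> _](s_div v) norm_s energy_s => ->.
have AV j x : \sum_y A x y * V j y = l j * V j x.
  by rewrite -(eigA j x).1; apply: eq_bigr => y _; rewrite -[in LHS]symA mxE mulrC.
have AW j x : \sum_y A x y * W j y = l j * W j x.
  by rewrite -(eigA j x).2; apply: eq_bigr => y _; rewrite -[in LHS]symA mxE mulrC.
have eV j : \sum_x V j x * (\sum_y A x y * V j y) = l j * \sum_x V j x ^+ 2.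
  by rewrite mulr_sumr; apply: eq_bigr => x _; rewrite AV; ring.
have eW j : \sum_x W j x * (\sum_y A x y * W j y) = l j * \sum_x W j x ^+ 2.
  by rewrite mulr_sumr; apply: eq_bigr => x _; rewrite AW; ring.
have unit1 j : \sum_x V j x ^+ 2 + \sum_x W j x ^+ 2 = 1.
  transitivity ((j == j)%:R : R); last by rewrite eqxx.
  rewrite -(orth j j).1 -big_split /=.
  by apply: eq_bigr => x _; rewrite !expr2.
have l_le1 j : l j <= 1.
  have := lerD (contr (V j)) (contr (W j)).
  by rewrite eV eW -mulrDr unit1 mulr1.
have fixed j : l j = 1 -> exists a b, [/\ forall x, V j x = a * s x,
    forall x, W j x = b * s x & a ^+ 2 + b ^+ 2 = 1].
  move=> lj; have := eV j; have := eW j; rewrite lj !mul1r.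
  move=> /eqcase [b Wb] /eqcase [a Va]; exists a, b; split=> //.
  rewrite -(unit1 j).
  under eq_bigr do rewrite Va exprMn [s _ ^+ 2]expr2 ss.
  under [X in _ = _ + X]eq_bigr do rewrite Wb exprMn [s _ ^+ 2]expr2 ss.
  by rewrite -!mulr_sumr p_sum !mulr1.
have [j0 /eqP lj0] : exists j, l j == 1.
  apply/existsP; apply: contraT; rewrite negb_exists => /forallP ltl.
  have l_lt1 j : l j < 1 by rewrite lt_neqAle l_le1 andbT; apply: contraNN (ltl j).
  have Ew : \sum_j w s j = 1.
    by rewrite -normA -p_sum; apply: eq_bigr => x _; rewrite expr2 ss.
  have : \sum_j (1 - l j) * w s j = 0.
    under eq_bigr do rewrite mulrBl mul1r.
    rewrite sumrB -qformA Ew; apply/eqP; rewrite subr_eq0 -p_sum; apply/eqP.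
    apply: eq_bigr => x _; rewrite -ss; congr (_ * _).
    transitivity (s x * \sum_y Q x y); first by rewrite Q_sum mulr1.
    by rewrite mulr_sumr; apply: eq_bigr => y _; rewrite mxE divfK.
  move/eqP; rewrite psumr_eq0; last by move=> j _; rewrite mulr_ge0 // subr_ge0 l_le1.
  move=> /allP w0; move: Ew; rewrite big1 => [/esym /eqP|j _]; first by rewrite oner_eq0.
  have := w0 j (mem_index_enum _).
  by rewrite mulf_eq0 subr_eq0 [1 == _]eq_sym (lt_eqF (l_lt1 j)) => /eqP.
(* Two eigenvectors of eigenvalue 1 would be complex multiples of the same
   vector, hence not orthogonal. *)
have uniq1 j : j != j0 -> l j < 1.
  move=> jj0; rewrite lt_neqAle l_le1 andbT; apply/eqP => lj.
  have [a [b [Va Wb ab]]] := fixed j lj.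
  have [a' [b' [Va' Wb' ab']]] := fixed j0 lj0.
  have [] := orth j j0; rewrite (negPf jj0).
  under eq_bigr do rewrite Va Va' Wb Wb' mulrACA ss [b * _ * _]mulrACA ss -mulrDl.
  rewrite -mulr_sumr p_sum mulr1 => o1.
  under eq_bigr do rewrite Wb Va' mulrACA ss.
  under [X in _ = X -> _]eq_bigr do rewrite Va Wb' mulrACA ss.
  rewrite -!mulr_sumr p_sum !mulr1 => o2.
  have : (a ^+ 2 + b ^+ 2) * (a' ^+ 2 + b' ^+ 2) =
    (a * a' + b * b') ^+ 2 + (b * a' - a * b') ^+ 2 by ring.
  by rewrite ab ab' o1 o2 subrr expr0n addr0 mulr1 => /eqP; rewrite oner_eq0.
have [ltl2 lel2] : nth 0 (spectrum Q) 1 < 1 /\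
    forall j, j != j0 -> l j <= nth 0 (spectrum Q) 1.
  have perm1 : perm_eq [seq l j | j <- enum 'I_m]
      (1 :: [seq l j | j <- rem j0 (enum 'I_m)]).
    by rewrite -lj0 -map_cons perm_map // perm_to_rem // mem_enum.
  have := perm_size permS; rewrite size_map size_enum_ord.
  have {perm1}permS : perm_eq (spectrum Q) (1 :: [seq l j | j <- rem j0 (enum 'I_m)]).
    exact: perm_trans perm1.
  move: sortS permS; case: (spectrum Q) => [|a [|b t]] /= sortS permS szS.
  - by have := m_gt1; rewrite -{1}szS.
  - by have := m_gt1; rewrite -{1}szS.
  have /andP[ba sortt] := sortS.
  have sub1 z : z \in rem j0 (enum 'I_m) -> z != j0.
    by rewrite mem_rem_uniq ?enum_uniq // inE => /andP[].
  have a1 : a = 1.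
    apply/eqP; rewrite eq_le; apply/andP; split.
      have : a \in 1 :: [seq l j | j <- rem j0 (enum 'I_m)].
        by rewrite -(perm_mem permS) mem_head.
      by rewrite inE => /predU1P[->|/mapP[j _ ->]].
    have : 1 \in [:: a, b & t] by rewrite (perm_mem permS) mem_head.
    rewrite inE => /predU1P[<-//|in1].
    by have /allP ge_a := @order_path_min _ >=%R a (b :: t) ge_trans sortS; exact: ge_a.
  move: permS; rewrite a1 perm_cons => permS; split.
    have : b \in [seq l j | j <- rem j0 (enum 'I_m)] by rewrite -(perm_mem permS) mem_head.
    by case/mapP => j /sub1 /uniq1 lj ->.
  move=> j jj0.
  have : l j \in b :: t.
    by rewrite (perm_mem permS) map_f // mem_rem_uniq ?enum_uniq // inE jj0 mem_enum.
  rewrite inE => /predU1P[->//|ljt].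
  have /allP ge_b := @order_path_min _ >=%R b t ge_trans sortt; exact: ge_b.
split=> // u; set l2 := nth 0 _ _ in ltl2 lel2 *.
rewrite -norm_s -energy_s normA qformA.
set v := fun x => s x * u x.
have -> : (\sum_x p x * u x) ^+ 2 = w v j0.
  have [a [b [Va Wb ab]]] := fixed j0 lj0; rewrite /w.
  under [in RHS]eq_bigr do rewrite Va -mulrA [s _ * (s _ * _)]mulrA ss.
  under [in X in _ + X]eq_bigr do rewrite Wb -mulrA [s _ * (s _ * _)]mulrA ss.
  by rewrite -!mulr_sumr !exprMn -mulrDl ab mul1r.
rewrite (bigD1 j0) //= [X in l2 * X](bigD1 j0) //= lj0.
set S := \sum_(i < m | i != j0) w v i.
have -> : l2 * (w v j0 + S) + (1 - l2) * w v j0 = 1 * w v j0 + l2 * S by ring.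
rewrite lerD2l /S mulr_sumr.
by apply: ler_sum => j jj0; rewrite ler_wpM2r // lel2.
Qed.
End Gap.

(** * Exponential moments of an irreversible chain *)

Section MultSymm.
Variables (R : realType) (m : nat) (P : 'M[R]_m) (p : 'I_m -> R).
Hypotheses (m_gt1 : (1 < m)%N) (p_gt0 : forall x, 0 < p x).
Hypotheses (Pst : stochastic P) (stat : stationary P p).
Let P_ge0 x y : 0 <= P x y. Proof. by case: Pst. Qed.
Let P_sum x : \sum_y P x y = 1. Proof. by case: Pst. Qed.
Let p_sum : \sum_x p x = 1. Proof. by case: stat. Qed.
Let pP y : \sum_x p x * P x y = p y. Proof. by case: stat. Qed.
Let p_ge0 x : 0 <= p x. Proof. exact: ltW. Qed.

Lemma mult_symmE x y : p x * mult_symm P p x y = \sum_z p z * P z x * P z y.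
Proof.
rewrite mxE mulr_sumr; apply: eq_bigr => z _; rewrite mxE mulrA; congr (_ * _).
by rewrite mulrC divfK // gt_eqF.
Qed.

Lemma mult_symm_reversible x y :
  p x * mult_symm P p x y = p y * mult_symm P p y x.
Proof. by rewrite !mult_symmE; apply: eq_bigr => z _; rewrite mulrAC. Qed.

Lemma mult_symm_stochastic : stochastic (mult_symm P p).
Proof.
split=> [x y|x].
  rewrite -(pmulr_rge0 _ (p_gt0 x)) mult_symmE; apply: sumr_ge0 => z _.
  by rewrite !mulr_ge0.
apply: (mulfI (lt0r_neq0 (p_gt0 x))); rewrite mulr_sumr mulr1.
under eq_bigr do rewrite mult_symmE.
rewrite exchange_big /= -[RHS]pP; apply: eq_bigr => z _.
by rewrite -mulr_sumr P_sum mulr1.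
Qed.

(** [<w, P'P w> = |P w|^2] in [l2(p)]. *)
Lemma mult_symm_energy (w : 'I_m -> R) :
  \sum_x p x * w x * (\sum_y mult_symm P p x y * w y) =
  \sum_z p z * (\sum_x P z x * w x) ^+ 2.
Proof.
transitivity (\sum_x \sum_y \sum_z p z * ((P z x * w x) * (P z y * w y))).
  apply: eq_bigr => x _; rewrite mulr_sumr; apply: eq_bigr => y _.
  transitivity (w x * w y * (p x * mult_symm P p x y)); first by ring.
  by rewrite mult_symmE mulr_sumr; apply: eq_bigr => z _; ring.
under eq_bigr do rewrite exchange_big.
rewrite exchange_big; apply: eq_bigr => z _ /=.
rewrite expr2 mulr_suml mulr_sumr; apply: eq_bigr => x _.
by rewrite !mulr_sumr.
Qed.

(** The form in which the gap is used: [P] contracts the part of [w] orthogonal to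
    the constants. Any smaller [eps] is also valid, by Jensen's inequality. *)
Lemma symm_gap_contraction (eps : R) : irreducible (mult_symm P p) ->
  eps <= eigen_gap (mult_symm P p) -> forall w : 'I_m -> R,
  \sum_z p z * (\sum_x P z x * w x) ^+ 2 <=
  (1 - eps) * (\sum_x p x * w x ^+ 2) + eps * (\sum_x p x * w x) ^+ 2.
Proof.
move=> irr; rewrite /eigen_gap => leps w; rewrite -mult_symm_energy.
have [_ /(_ w) gapP] := spectral_gap m_gt1 p_gt0 p_sum mult_symm_stochastic irr
  mult_symm_reversible.
apply: le_trans gapP _; set l2 := nth 0 _ 1 in leps *.
set A := \sum_x p x * w x ^+ 2; set b := \sum_x p x * w x.
have bA : b ^+ 2 <= A.
  rewrite -subr_ge0.
  have -> : A - b ^+ 2 = \sum_x p x * (w x - b) ^+ 2.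
    transitivity (\sum_x (p x * w x ^+ 2 - 2 * b * (p x * w x) + p x * b ^+ 2)).
      rewrite big_split /= sumrB -mulr_sumr -mulr_suml p_sum -/A -/b; ring.
    by apply: eq_bigr => x _; ring.
  by apply: sumr_ge0 => x _; rewrite mulr_ge0 ?sqr_ge0.
nra.
Qed.

Lemma eigen_gap_gt0 : irreducible (mult_symm P p) -> 0 < eigen_gap (mult_symm P p).
Proof.
move=> irr; rewrite subr_gt0.
by have [] := spectral_gap m_gt1 p_gt0 p_sum mult_symm_stochastic irr
  mult_symm_reversible.
Qed.

End MultSymm.

(** [mgf k x] is the expectation, for the chain started at [x], of
    [exp (theta * (f X_0 + ... + f X_(k-1)))]. *)
Section Mgf.
Variables (R : realType) (m : nat) (P : 'M[R]_m) (f : 'I_m -> R) (theta : R).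

Fixpoint mgf (k : nat) (x : 'I_m) : R :=
  if k is k'.+1 then expR (theta * f x) * \sum_y P x y * mgf k' y else 1.

End Mgf.

Section Concentration.
Variables (R : realType) (m : nat) (P : 'M[R]_m) (p f : 'I_m -> R) (eps g : R).
Hypotheses (p_gt0 : forall x, 0 < p x).
Hypotheses (Pst : stochastic P) (stat : stationary P p).
Hypotheses (eps_gt0 : 0 < eps) (eps_le1 : eps <= 1) (g_ge0 : 0 <= g) (g_le1 : g <= 1).
Hypotheses (f_le1 : forall x, `|f x| <= 1) (f_mean : \sum_x f x * p x = 0).
Hypothesis contr : forall w : 'I_m -> R,
  \sum_z p z * (\sum_x P z x * w x) ^+ 2 <=
  (1 - eps) * (\sum_x p x * w x ^+ 2) + eps * (\sum_x p x * w x) ^+ 2.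
Let P_ge0 x y : 0 <= P x y. Proof. by case: Pst. Qed.
Let P_sum x : \sum_y P x y = 1. Proof. by case: Pst. Qed.
Let p_sum : \sum_x p x = 1. Proof. by case: stat. Qed.
Let p_ge0 x : 0 <= p x. Proof. exact: ltW. Qed.

Let theta := g * eps / 12.
(** The choice of [theta] and [kappa]: [avg_bound] needs
    [kappa >= 8 theta^2 / eps + 2 kappa^2 / eps], which after division by
    [g^2 eps] follows from [1/15 >= 1/18 + 2/225], and the exponent gained per
    sample is [theta g - kappa / 2 = g^2 eps / 20]. *)
Let kappa := g ^+ 2 * eps / 15.

Let u x := 2 * (theta * f x) - kappa.

Let u_small x : u x / eps <= 1 / 2.
Proof.
rewrite ler_pdivrMr // /u /theta /kappa.
have fx1 : f x <= 1 by have := f_le1 x; rewrite ler_norml => /andP[].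
have ge0 : 0 <= g * eps by rewrite mulr_ge0 // ltW.
have gf : g * eps * f x <= g * eps by rewrite ler_piMr.
have ge1 : g * eps <= eps by rewrite ler_piMl // ltW.
have g2 : 0 <= g ^+ 2 * eps by rewrite mulr_ge0 ?sqr_ge0 // ltW.
have := eps_gt0; lra.
Qed.

Let u_lt x : 0 < eps - u x.
Proof. by have := u_small x; rewrite ler_pdivrMr //; have := eps_gt0; lra. Qed.

Let inv_bound (z : R) : z <= 1 / 2 -> (1 - z)^-1 <= 1 + z + 2 * z ^+ 2.
Proof.
move=> z2; rewrite -[leLHS]div1r ler_pdivrMr; last lra.
have : 0 <= z ^+ 2 * (1 - 2 * z) by rewrite mulr_ge0 ?sqr_ge0 //; lra.
lra.
Qed.

(** The condition for the rank-one perturbation in [tilted_contraction] to keep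
    the squared norm below [e^kappa]; since [1 / (1 - z) <= 1 + z + 2 z^2] for
    [z <= 1/2], it only involves the mean and the second moment of [f]. *)
Let avg_bound : \sum_x p x * (eps / (eps - u x)) <= 1.
Proof.
apply: (@le_trans _ _ (\sum_x p x * (1 + u x / eps + 2 * (u x / eps) ^+ 2))).
  apply: ler_sum => x _; rewrite ler_wpM2l //.
  have -> : eps / (eps - u x) = (1 - u x / eps)^-1.
    have -> : 1 - u x / eps = (eps - u x) / eps by field; rewrite gt_eqF.
    by rewrite invf_div.
  exact: inv_bound.
have e0 : eps != 0 by rewrite gt_eqF.
pose V := \sum_x p x * f x ^+ 2.
have V1 : V <= 1.
  rewrite -p_sum; apply: ler_sum => x _; rewrite ler_piMr //.
  by rewrite -real_normK ?num_real // exprn_ile1.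
have -> : \sum_x p x * (1 + u x / eps + 2 * (u x / eps) ^+ 2) =
   (1 - kappa / eps + 2 * (kappa / eps) ^+ 2) * \sum_x p x
   + (2 * theta / eps - 8 * theta * kappa / eps ^+ 2) * \sum_x f x * p x
   + 8 * (theta / eps) ^+ 2 * V.
  rewrite /V !mulr_sumr -!big_split /=; apply: eq_bigr => x _; rewrite /u.
  by field.
rewrite p_sum f_mean mulr0 addr0 mulr1.
have -> : kappa / eps = g ^+ 2 / 15 by rewrite /kappa; field.
have -> : theta / eps = g / 12 by rewrite /theta; field.
have : (g / 12) ^+ 2 * V <= (g / 12) ^+ 2 by rewrite ler_piMr // sqr_ge0.
have g2 : g ^+ 2 <= 1 by rewrite exprn_ile1.
have := sqr_ge0 g; set h := g ^+ 2 in g2 *.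
have -> : (g / 12) ^+ 2 = h / 144 by rewrite /h; field.
nra.
Qed.

Let Dx x := expR (theta * f x).

(** Cauchy-Schwarz with the weight [q = e^kappa - (1 - eps) D^2], written as the
    nonnegativity of a square; [e^(-u) >= 1 - u] bounds [D^2 / q]. *)
Let tilted_contraction (w : 'I_m -> R) :
  \sum_z p z * (\sum_x P z x * (Dx x * w x)) ^+ 2 <=
    expR kappa * \sum_x p x * w x ^+ 2.
Proof.
apply: le_trans (contr _) _.
pose q x := expR kappa - (1 - eps) * Dx x ^+ 2.
have D2 x : Dx x ^+ 2 = expR kappa * expR (u x).
  by rewrite -expRD /Dx expr2 -expRD; congr expR; rewrite /u; lra.
have q_lower x : Dx x ^+ 2 * (eps - u x) <= q x.
  have -> : q x = Dx x ^+ 2 * (eps - u x) + (expR kappa - Dx x ^+ 2 * (1 - u x)).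
    by rewrite /q; ring.
  rewrite lerDl subr_ge0 D2 -mulrA ger_pMr ?expR_gt0 // mulrC.
  rewrite -ler_pdivlMr ?expR_gt0 // mul1r -expRN; exact: expR_ge1Dx.
have q_gt0 x : 0 < q x.
  apply: lt_le_trans (q_lower x); rewrite mulr_gt0 // exprn_gt0 // expR_gt0 //.
pose S := \sum_x p x * (Dx x * w x).
pose A := \sum_x p x * (Dx x ^+ 2 / q x).
have A_le : A <= eps^-1.
  rewrite -[leRHS]mul1r ler_pdivlMr //; apply: le_trans avg_bound.
  rewrite mulr_suml; apply: ler_sum => x _; rewrite -mulrA ler_wpM2l //.
  rewrite mulrC ler_wpM2l ?(ltW eps_gt0) //.
  rewrite ler_pdivrMr // ler_pdivlMl //.
  by rewrite mulrC.
have : 0 <= \sum_x p x * q x * (w x - eps * S * Dx x / q x) ^+ 2.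
  by apply: sumr_ge0 => x _; rewrite mulr_ge0 ?sqr_ge0 // mulr_ge0 // ltW.
have -> : \sum_x p x * q x * (w x - eps * S * Dx x / q x) ^+ 2 =
   \sum_x p x * q x * w x ^+ 2 - 2 * eps * S * S + (eps * S) ^+ 2 * A.
  have gen s : \sum_x p x * q x * (w x - eps * s * Dx x / q x) ^+ 2 =
     \sum_x p x * q x * w x ^+ 2 - 2 * eps * s * \sum_x p x * (Dx x * w x)
     + (eps * s) ^+ 2 * \sum_x p x * (Dx x ^+ 2 / q x).
    rewrite !mulr_sumr -sumrB -big_split /=; apply: eq_bigr => x _.
    by have := lt0r_neq0 (q_gt0 x); move: (q x) => qx qx0; field.
  exact: gen.
have -> : \sum_x p x * q x * w x ^+ 2 =
   expR kappa * \sum_x p x * w x ^+ 2 - (1 - eps) * \sum_x p x * (Dx x * w x) ^+ 2.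
  by rewrite !mulr_sumr -sumrB; apply: eq_bigr => x _; rewrite /q; ring.
have : (eps * S) ^+ 2 * A <= eps * S ^+ 2.
  have -> : eps * S ^+ 2 = (eps * S) ^+ 2 * eps^-1 by field; rewrite gt_eqF.
  by rewrite ler_wpM2l // sqr_ge0.
rewrite -/S; nra.
Qed.

Let drift_norm k : \sum_z p z * (\sum_y P z y * mgf P f theta k y) ^+ 2 <= expR (kappa *+ k).
Proof.
elim: k => [|k IH].
  rewrite mulr0n expR0 -p_sum; apply: ler_sum => z _.
  by under eq_bigr do rewrite /= mulr1; rewrite P_sum expr1n mulr1.
rewrite mulrSr expRD mulrC; apply: le_trans (tilted_contraction _) _.
by rewrite ler_wpM2l // expR_ge0.
Qed.

Lemma mgf_ge0 th k x : 0 <= mgf P f th k x.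
Proof.
elim: k x => [|k IH] x //=; rewrite mulr_ge0 ?expR_ge0 //.
by apply: sumr_ge0 => y _; rewrite mulr_ge0.
Qed.

(** The norm estimate applies to [P D], so the first factor [D] of the product is
    bounded separately (by 2); a function of norm [c] in [l2(p)] is at most
    [c / sqrt (p x) <= c / p x] at [x]. *)
Lemma mgf_chernoff k x :
  expR (- (theta * g) *+ k) * mgf P f theta k x <=
    2 / p x * expR (- (g ^+ 2 * eps / 20) *+ k).
Proof.
have px1 : p x <= 1.
  by rewrite -p_sum (bigD1 x) //= lerDl sumr_ge0.
case: k => [|k].
  rewrite !mulr0n expR0 !mulr1 /=.
  by rewrite ler_pdivlMr // mul1r (le_trans px1) // ler1n.
have eqE : - (g ^+ 2 * eps / 20) *+ k.+1 = - (theta * g) *+ k.+1 + (kappa / 2) *+ k.+1.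
  by rewrite -mulrnDl; congr (_ *+ _); rewrite /theta /kappa; field.
rewrite eqE expRD [leRHS]mulrCA ler_wpM2l ?expR_ge0 //=.
set uk := \sum_y _.
have uk_ge0 : 0 <= uk.
  by apply: sumr_ge0 => y _; rewrite mulr_ge0 // mgf_ge0.
have D_le2 : expR (theta * f x) <= 2.
  have : theta * f x <= 1 / 2.
    have : f x <= 1 by have := f_le1 x; rewrite ler_norml => /andP[].
    rewrite /theta; have := mulr_ge0 g_ge0 (ltW eps_gt0).
    have : g * eps <= 1 by rewrite mulr_ile1 // ltW.
    nra.
  move=> h; have := expR_ge1Dx (- (theta * f x)); rewrite expRN => h'.
  have e0 : 0 < expR (theta * f x) by exact: expR_gt0.
  have : 1 / 2 <= (expR (theta * f x))^-1 by apply: le_trans h'; lra.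
  by rewrite div1r lef_pV2 ?posrE.
have uk_le : uk <= expR ((kappa / 2) *+ k) / p x.
  rewrite -(@ler_pXn2r _ 2) ?nnegrE ?divr_ge0 ?expR_ge0 //.
  apply: (@le_trans _ _ (expR (kappa *+ k) / p x)).
    rewrite ler_pdivlMr // mulrC; apply: le_trans (drift_norm k).
    rewrite (bigD1 x) //= lerDl sumr_ge0 // => y _.
    by rewrite mulr_ge0 ?sqr_ge0.
  rewrite expr_div_n ler_pM ?expR_ge0 ?invr_ge0 //.
    by rewrite expr2 -expRD -mulrnDl -splitr.
  by rewrite lef_pV2 ?posrE ?exprn_gt0 // expr2 ger_pMl.
rewrite -[leRHS]mulrA [X in _ <= 2 * X]mulrC ler_pM ?expR_ge0 //.
apply: le_trans uk_le _; rewrite ler_wpM2r ?invr_ge0 // ler_expR.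
by rewrite [leRHS]mulrSr lerDl /kappa divr_ge0 // divr_ge0 // mulr_ge0 ?sqr_ge0 // ltW.
Qed.

End Concentration.

(** * Hitting times and the Poisson equation *)

Lemma sum_tuple_cons (V : nmodType) (J : finType) t (F : seq J -> V) :
  \sum_(s : t.+1.-tuple J) F s = \sum_y \sum_(s : t.-tuple J) F (y :: s).
Proof.
rewrite pair_bigA /= (reindex (fun u : J * t.-tuple J => [tuple of u.1 :: u.2])) //.
exists (fun s : t.+1.-tuple J => (thead s, [tuple of behead s])).
  by move=> [y s] _ /=; congr (_, _); apply: val_inj.
by move=> s _; rewrite [RHS]tuple_eta.
Qed.

Section Hitting.
Variables (R : realType) (m : nat) (P : 'M[R]_m).
Hypotheses (Pst : stochastic P) (Pirr : irreducible P).
Let P_ge0 x y : 0 <= P x y. Proof. by case: Pst. Qed.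
Let P_sum x : \sum_y P x y = 1. Proof. by case: Pst. Qed.

Lemma power_ge0 k x y : 0 <= (P ^+ k) x y.
Proof.
elim: k x => [|k IH] x; first by rewrite expr0 mxE ler0n.
by rewrite exprS mxE sumr_ge0 // => v _; rewrite mulr_ge0.
Qed.

Lemma power_sum k x : \sum_y (P ^+ k) x y = 1.
Proof.
elim: k x => [|k IH] x.
  rewrite expr0 (bigD1 x) //= mxE eqxx big1 ?addr0 // => y yx.
  by rewrite mxE eq_sym (negPf yx).
rewrite exprS; under eq_bigr do rewrite mxE.
rewrite exchange_big /= -[RHS](P_sum x); apply: eq_bigr => y _.
by rewrite -mulr_sumr IH mulr1.
Qed.

Section Target.
Variable z : 'I_m.

(** [avoid t x] is the probability that the chain started at [x] does not visit
    [z] at the times [1, ..., t]. *)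
Fixpoint avoid (t : nat) (x : 'I_m) : R :=
  if t is t'.+1 then \sum_(y | y != z) P x y * avoid t' y else 1.

Lemma first_hit_prob0 x : first_hit_prob P x z 0 = P x z.
Proof.
rewrite /first_hit_prob big_mkcond /=.
rewrite (sum_tuple_cons _ (fun s => if index z s == 0%N then path_prob P x s else 0)).
rewrite (bigD1 z) //= [X in _ + X]big1 ?addr0 => [|y yz].
  rewrite (eq_bigr (fun=> P x z)) => [|s _].
    by rewrite sumr_const card_tuple expn0.
  by rewrite [tval s]size0nil ?size_tuple //= eqxx mulr1.
by rewrite big1 // => s _; rewrite (negPf yz).
Qed.

Lemma first_hit_probS t x :
  first_hit_prob P x z t.+1 = \sum_(y | y != z) P x y * first_hit_prob P y z t.
Proof.
rewrite /first_hit_prob big_mkcond /=.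
rewrite (sum_tuple_cons _ (fun s => if index z s == t.+1 then path_prob P x s else 0)).
rewrite (bigD1 z) //= [X in X + _]big1 ?add0r => [|s _]; last by rewrite eqxx.
apply: eq_bigr => y yz; rewrite mulr_sumr [RHS]big_mkcond /=.
by apply: eq_bigr => s _; rewrite (negPf yz) eqSS; case: ifP.
Qed.

Lemma first_hit_probE t x : first_hit_prob P x z t = avoid t x - avoid t.+1 x.
Proof.
elim: t x => [|t IH] x.
  rewrite first_hit_prob0 /=; under [X in _ - X]eq_bigr do rewrite mulr1.
  by rewrite -(P_sum x) [in RHS](bigD1 z) //= addrK.
rewrite first_hit_probS /= -sumrB; apply: eq_bigr => y _.
by rewrite IH mulrBr.
Qed.

Lemma avoid_ge0 t x : 0 <= avoid t x.
Proof. by elim: t x => //= t IH x; apply: sumr_ge0 => y _; rewrite mulr_ge0. Qed.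

Lemma sub_stochastic_le (u : 'I_m -> R) c x : 0 <= c -> (forall y, y != z -> u y <= c) ->
  \sum_(y | y != z) P x y * u y <= c.
Proof.
move=> c0 uc; apply: (@le_trans _ _ (\sum_(y | y != z) P x y * c)).
  by apply: ler_sum => y yz; rewrite ler_wpM2l // uc.
by rewrite -mulr_suml ler_piMl // -(P_sum x) [leRHS](bigD1 z) //= lerDr.
Qed.

Lemma avoid_le1 t x : avoid t x <= 1.
Proof. by elim: t x => //= t IH x; apply: sub_stochastic_le => // y _; apply: IH. Qed.

Lemma avoid_decr t x : avoid t.+1 x <= avoid t x.
Proof.
elim: t x => [|t IH] x; first exact: (avoid_le1 1).
by apply: ler_sum => y _; apply: ler_wpM2l => //; exact: IH.
Qed.

Lemma avoid_noninc x t k : (t <= k)%N -> avoid k x <= avoid t x.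
Proof.
elim: k => [|k IH]; first by rewrite leqn0 => /eqP ->.
by rewrite leq_eqVlt => /predU1P[->//|/IH]; apply: le_trans; exact: avoid_decr.
Qed.

Lemma avoid_power k x : x != z -> avoid k x <= 1 - (P ^+ k) x z.
Proof.
elim: k x => [|k IH] x xz; first by rewrite expr0 mxE (negPf xz) subr0.
rewrite /= exprS mxE.
apply: (@le_trans _ _ (\sum_y P x y * (1 - (P ^+ k) y z))); last first.
  under eq_bigr do rewrite mulrBr mulr1.
  by rewrite sumrB P_sum.
rewrite [leRHS](bigD1 z) //= -[leLHS]add0r lerD //; last first.
  by apply: ler_sum => y yz; rewrite ler_wpM2l // IH.
rewrite mulr_ge0 // subr_ge0.
by rewrite -(power_sum k z) [leRHS](bigD1 z) //= lerDl sumr_ge0 // => *; exact: power_ge0.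
Qed.

(** Irreducibility makes the avoidance probability strictly smaller than 1 at some
    time common to all starting points, hence geometrically decreasing. One more
    step is needed for the starting point [z] itself. *)
Lemma avoid_contraction : exists (k : nat) (rho : R),
  [/\ 0 <= rho < 1 & forall x, avoid k x <= rho].
Proof.
have /choice [k kP] : forall x, exists k : nat, x != z -> avoid k x < 1.
  move=> x; have [k Pk] := Pirr x z; exists k => xz.
  by apply: le_lt_trans (avoid_power _ xz) _; rewrite ltrBlDr ltrDl.
pose k1 := (\max_x k x)%N.
pose rho := \big[Num.max/0]_(x | x != z) avoid k1 x.
exists k1.+1, rho; split.
  apply/andP; split; first exact: bigmax_ge_id.
  apply/bigmax_ltP; split=> // x xz; apply: le_lt_trans (kP x xz).
  exact/avoid_noninc/leq_bigmax.
move=> x /=; apply: sub_stochastic_le; first exact: bigmax_ge_id.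
by move=> y yz; apply: (le_bigmax_cond _ (fun y => avoid k1 y)).
Qed.

Lemma avoidD k rho t x : 0 <= rho -> (forall y, avoid k y <= rho) ->
  avoid (t + k) x <= rho * avoid t x.
Proof.
move=> rho0 le_rho; elim: t x => [|t IH] x; first by rewrite mulr1.
by rewrite addSn /= mulr_sumr; apply: ler_sum => y _; rewrite mulrCA ler_wpM2l.
Qed.

Lemma avoid_series_cvg x : cvgn (series (fun t => avoid t x)).
Proof.
have [k [rho [/andP[rho0 rho1] le_rho]]] := avoid_contraction.
apply: nondecreasing_is_cvgn.
  by apply: nondecreasing_series => t _ _; exact: avoid_ge0.
exists (k%:R / (1 - rho)) => _ [n _ <-].
rewrite ler_pdivlMr ?subr_gt0 // mulrBr mulr1 lerBlDr /series /=.
apply: (@le_trans _ _ (\sum_(0 <= t < n + k) avoid t x)).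
  by rewrite (big_cat_nat _ (leq_addr k n)) //= lerDl sumr_ge0 // => t _; exact: avoid_ge0.
rewrite addnC (big_cat_nat _ (leq_addr n k)) //= lerD //.
  rewrite -[leRHS]mulr1 mulr_natl -[k in leRHS]subn0 -sumr_const_nat.
  by apply: ler_sum => t _; exact: avoid_le1.
rewrite -{1}[k]add0n big_addn addnC addnK mulrC mulr_sumr.
by apply: ler_sum => t _; exact: avoidD.
Qed.

Definition hit_mean (x : 'I_m) : R := limn (series (fun t => avoid t x)).

Lemma avoid_partial_le n x : \sum_(0 <= t < n) avoid t x <= hit_mean x.
Proof.
apply: (@nondecreasing_cvgn_le _ (series (fun t => avoid t x))).
  by apply: nondecreasing_series => t _ _; exact: avoid_ge0.
exact: avoid_series_cvg.
Qed.

Lemma hit_mean_ge0 x : 0 <= hit_mean x.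
Proof. by apply: le_trans (avoid_partial_le 0 x); rewrite big_nil. Qed.

Lemma hit_mean_step x : hit_mean x = 1 + \sum_(y | y != z) P x y * hit_mean y.
Proof.
apply: cvg_lim => //; rewrite -(cvg_shiftn 1).
have -> : [sequence series (fun t => avoid t x) (n + 1)%N]_n =
   (fun n => 1 + \sum_(y | y != z) P x y * series (fun t => avoid t y) n).
  apply/funext => n /=; rewrite addn1 /series /= big_nat_recl //=; congr (_ + _).
  rewrite exchange_big /=; apply: eq_bigr => y _; by rewrite mulr_sumr.
apply: cvgD; first exact: cvg_cst.
apply: cvg_big => [|y _]; first exact: add_continuous.
by apply: cvgM; [exact: cvg_cst|exact: avoid_series_cvg].
Qed.

Lemma avoid_cvg0 x : (fun n => avoid n x) @ \oo --> (0 : R).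
Proof. apply: (@cvg_series_cvg_0 R R^o); exact: avoid_series_cvg. Qed.

Lemma weighted_first_hit n x :
  \sum_(0 <= t < n) t.+1%:R * first_hit_prob P x z t =
  \sum_(0 <= t < n) (avoid t x - avoid n x).
Proof.
elim: n => [|n IH]; first by rewrite !big_nil.
rewrite big_nat_recr //= IH first_hit_probE big_nat_recr //=.
rewrite !sumrB !sumr_const_nat !subn0 -[in LHS]mulr_natl -[in RHS]mulr_natl -natr1; ring.
Qed.

(** The partial sums of [mean_hit] are [\sum_(t < n) (avoid t x - avoid n x)];
    keeping only the first [k] terms and letting [n] grow, then [k], avoids
    proving that [n * avoid n x] vanishes. *)
Lemma hit_mean_le x : hit_mean x <= mean_hit P x z.
Proof.
have ndW : nondecreasing_seq (series (fun t => t.+1%:R * first_hit_prob P x z t)).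
  apply: nondecreasing_series => t _ _; rewrite mulr_ge0 // first_hit_probE.
  by rewrite subr_ge0 avoid_decr.
have cvgW : cvgn (series (fun t => t.+1%:R * first_hit_prob P x z t)).
  apply: nondecreasing_is_cvgn => //; exists (hit_mean x) => _ [n _ <-].
  rewrite /series /= weighted_first_hit; apply: le_trans (avoid_partial_le n x).
  by apply: ler_sum => t _; rewrite gerBl avoid_ge0.
apply: limr_le; first exact: avoid_series_cvg.
near=> k.
have cvgk : (fun n => series (fun t => avoid t x) k - k%:R * avoid n x) @ \oo -->
    series (fun t => avoid t x) k.
  rewrite -[X in _ --> X]subr0 -[X in _ --> _ - X](mulr0 k%:R).
  by apply: cvgB; [exact: cvg_cst|apply: cvgM; [exact: cvg_cst|exact: avoid_cvg0]].
apply: (@le_trans _ _ (lim ((fun n => series (fun t => avoid t x) k - k%:R * avoid n x) @ \oo))).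
  by rewrite (cvg_lim _ cvgk).
apply: limr_le; first by apply/cvg_ex; exists (series (fun t => avoid t x) k).
near=> n; apply: le_trans (nondecreasing_cvgn_le ndW cvgW n).
have kn : (k <= n)%N by near: n; exact: nbhs_infty_ge.
rewrite /series /= weighted_first_hit (big_cat_nat _ kn) //=.
apply: (@le_trans _ _ (\sum_(0 <= t < k) (avoid t x - avoid n x))).
  by rewrite sumrB sumr_const_nat subn0 mulr_natl.
rewrite lerDl big_nat_cond sumr_ge0 // => t /andP[/andP[_ tn] _].
by rewrite subr_ge0 avoid_noninc // ltnW.
Unshelve. all: by end_near.
Qed.

End Target.

Variables (p : 'I_m -> R).
Hypothesis stat : stationary P p.
Let p_sum : \sum_x p x = 1. Proof. by case: stat. Qed.
Let pP y : \sum_x p x * P x y = p y. Proof. by case: stat. Qed.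
Let p_ge0 x : 0 <= p x. Proof. by case: stat. Qed.

Lemma stationary_gt0 x : 0 < p x.
Proof.
have pow k y : \sum_w p w * (P ^+ k) w y = p y.
  elim: k y => [|k IH] y.
    rewrite expr0 (bigD1 y) //= mxE eqxx mulr1 big1 ?addr0 // => w wy.
    by rewrite mxE (negPf wy) mulr0.
  rewrite exprSr; under eq_bigr do rewrite mxE mulr_sumr.
  rewrite exchange_big /= -[RHS]pP; apply: eq_bigr => w _.
  by rewrite -IH mulr_suml; apply: eq_bigr => v _; rewrite mulrA.
have [y py] : exists y, 0 < p y.
  apply/existsP; apply: contraT => /existsPn none.
  have : \sum_x p x <= 0 by apply: sumr_le0 => y _; rewrite leNgt none.
  by rewrite p_sum ler10.
have [k Pk] := Pirr y x; rewrite -(pow k x) (bigD1 y) //=.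
by rewrite ltr_pwDl ?mulr_gt0 // sumr_ge0 // => w _; rewrite mulr_ge0 // power_ge0.
Qed.

Definition hit_time (z x : 'I_m) : R := if x == z then 0 else hit_mean z x.

Lemma hit_time_ge0 z x : 0 <= hit_time z x.
Proof. by rewrite /hit_time; case: ifP => // _; exact: hit_mean_ge0. Qed.

Lemma hit_time_target z : hit_time z z = 0.
Proof. by rewrite /hit_time eqxx. Qed.

Lemma hit_time_le z x : hit_time z x <= max_hit P.
Proof.
rewrite /hit_time /max_hit; case: eqVneq => [_|xz]; first exact: bigmax_ge_id.
apply: le_trans (hit_mean_le z x) _.
apply: le_trans (le_bigmax _ _ x) => /=.
by apply: (le_bigmax_cond _ (fun y => mean_hit P x y)); rewrite eq_sym.
Qed.

Lemma hit_mean_hit_time z x : \sum_y P x y * hit_time z y = hit_mean z x - 1.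
Proof.
rewrite hit_mean_step [1 + _]addrC addrK (bigD1 z) //= hit_time_target mulr0 add0r.
by apply: eq_bigr => y yz; rewrite /hit_time (negPf yz).
Qed.

(** Kac's formula: average the first-step identity [hit_mean_hit_time] under the
    stationary law. *)
Lemma kac z : hit_mean z z = (p z)^-1.
Proof.
have pz := stationary_gt0 z.
have : \sum_x p x * (\sum_y P x y * hit_time z y) = \sum_x p x * hit_time z x.
  under eq_bigr do rewrite mulr_sumr.
  rewrite exchange_big; apply: eq_bigr => y _ /=.
  by rewrite -(pP y) mulr_suml; apply: eq_bigr => x _; rewrite mulrA.
under eq_bigr do rewrite hit_mean_hit_time mulrBr mulr1.
rewrite sumrB p_sum => /eqP; rewrite subr_eq => /eqP.
rewrite (bigD1 z) //= [in RHS](bigD1 z) //= hit_time_target mulr0 add0r addrC.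
have -> : \sum_(i < m | i != z) p i * hit_time z i = \sum_(i < m | i != z) p i * hit_mean z i.
  by apply: eq_bigr => x xz; rewrite /hit_time (negPf xz).
by move=> /addrI h; apply: (mulfI (lt0r_neq0 pz)); rewrite h divff ?gt_eqF.
Qed.

Lemma hit_time_step z x :
  \sum_y P x y * hit_time z y = hit_time z x - 1 + (x == z)%:R / p z.
Proof.
rewrite hit_mean_hit_time /hit_time; case: eqVneq => [->|_]; last by rewrite mul0r addr0.
by rewrite kac mul1r add0r addrC.
Qed.

(** The solution [\sum_z r z * p z * hit_time z x] has nonnegative terms and
    total weight the mean reward, which gives the two bounds. *)
Lemma poisson_solution (r : 'I_m -> R) : (forall x, 0 <= r x) ->
  exists gam : 'I_m -> R,
  [/\ forall x, 0 <= gam x <= (\sum_x r x * p x) * max_hit P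
    & forall x, \sum_y P x y * gam y = gam x - \sum_x r x * p x + r x].
Proof.
move=> r_ge0; exists (fun x => \sum_z r z * p z * hit_time z x); split=> x.
  apply/andP; split.
    by apply: sumr_ge0 => z _; rewrite !mulr_ge0 ?hit_time_ge0.
  by rewrite mulr_suml; apply: ler_sum => z _; rewrite ler_wpM2l ?hit_time_le // mulr_ge0.
under eq_bigr do rewrite mulr_sumr.
rewrite exchange_big /=.
under eq_bigr => z _.
  under eq_bigr do rewrite mulrCA.
  rewrite -mulr_sumr hit_time_step mulrDr mulrBr mulr1.
  over.
rewrite big_split sumrB /=; congr (_ + _).
rewrite (bigD1 x) //= eqxx mul1r mulfK ?gt_eqF ?stationary_gt0 //.
by rewrite big1 ?addr0 // => z zx; rewrite eq_sym (negPf zx) mul0r mulr0.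
Qed.

End Hitting.

(** * Finitely valued random variables and the Markov property *)

Section FiniteExpectation.
Context (R : realType) (d : measure_display) (T : measurableType d).
Variable Pr : probability T R.

Lemma expectation_finite (J : finType) (Z : T -> J) (g : J -> R) :
  (forall j, measurable [set w | Z w = j]) ->
  ('E_Pr[fun w => g (Z w)] = (\sum_j g j * fine (Pr [set w | Z w = j]))%:E)%E.
Proof.
move=> mZ; rewrite unlock.
transitivity (\int[Pr]_w (\sum_j (g j)%:E * (\1_[set w | Z w = j] w)%:E)%E)%E.
  apply: eq_integral => w _; rewrite (bigD1 (Z w)) //= big1 ?adde0 => [|j jZ].
    by rewrite indicE mem_set // mule1.
  by rewrite indicE memNset ?mule0 // => /esym/eqP; rewrite (negPf jZ).
rewrite integral_sum // => [|j]; last first.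
  by apply: integrableZl => //; exact: integrable_indic.
rewrite -sumEFin; apply: eq_bigr => j _.
rewrite integralZl //; last exact: integrable_indic.
rewrite integral_indic // setIT EFinM fineK //.
exact: fin_num_measure.
Qed.

Lemma measure_partition (J : finType) (Z : T -> J) (A : set T) :
  (forall j, measurable (A `&` [set w | Z w = j])) ->
  Pr A = (\sum_j Pr (A `&` [set w | Z w = j]))%E.
Proof.
move=> mAZ.
have AE : A = \bigcup_(j in [set` enum J]) (A `&` [set w | Z w = j]).
  apply/seteqP; split=> w; last by case=> j _ [].
  by move=> Aw; exists (Z w) => //=; rewrite mem_enum.
rewrite [in LHS]AE measure_fin_bigcup //.
  by rewrite -fsbig_seq ?enum_uniq // big_enum.
by move=> j k _ _ [w [[_ <-] [_ <-]]].
Qed.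

(** The Markov property conditionally on an arbitrary event of the past, such as
    the observation of the chain at some of the times only: decompose the event
    into full paths. *)
Lemma markov_chain_step (m : nat) (P : 'M[R]_m) (X : nat -> T -> 'I_m)
    (t : nat) (Q : set (nat -> 'I_m)) (x y : 'I_m) :
  markov_chain Pr P X ->
  (forall h h' : nat -> 'I_m, (forall s, (s <= t)%N -> h s = h' s) -> Q h -> Q h') ->
  Pr [set w | [/\ Q (fun s => X s w), X t w = x & X t.+1 w = y]] =
  (Pr [set w | Q (fun s => X s w) /\ X t w = x] * (P x y)%:E)%E.
Proof.
move=> [mX markov] locQ.
pose path (h : t.+1.-tuple 'I_m) (s : nat) := nth x h s.
pose cyl (h : t.+1.-tuple 'I_m) := [set w | forall s, (s <= t)%N -> X s w = path h s].
have mcyl h : measurable (cyl h).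
  have -> : cyl h = \bigcap_s (if (s <= t)%N then [set w | X s w = path h s] else setT).
    apply/seteqP; split=> w /= H s.
      by move=> _; case: ifP => // /H.
    by move=> st; have := H s I; rewrite st.
  by apply: bigcapT_measurable => s; case: ifP.
pose prefix w := [tuple X (nat_of_ord s) w | s < t.+1].
have prefixE w s : (s <= t)%N -> path (prefix w) s = X s w.
  move=> st; rewrite /path -[s]/(nat_of_ord (Ordinal (st : (s < t.+1)%N))) -tnth_nth.
  by rewrite tnth_mktuple.
have cylP h w : cyl h w -> prefix w = h.
  move=> H; apply: eq_from_tnth => s; rewrite tnth_mktuple (tnth_nth x) H //.
  by rewrite -ltnS.
have cylQ h : [set w | Q (fun s => X s w) /\ X t w = x] `&` cyl h =
    if `[< Q (path h) /\ path h t = x >] then cyl h else set0.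
  case: asboolP => [[Qh ht]|nQ]; apply/seteqP; split=> w //=.
  - by case.
  - move=> H; split=> //; split; last by rewrite H.
    by apply: locQ Qh => s st; rewrite H.
  - case=> -[Qw Xw] H; apply: nQ; split; last by rewrite -H.
    by apply: locQ Qw => s st; rewrite H.
have preE h : [set w | prefix w = h] = cyl h.
  apply/seteqP; split=> w /=; last exact: cylP.
  by move=> <- s st; rewrite prefixE.
have mQ h : measurable ([set w | Q (fun s => X s w) /\ X t w = x] `&` cyl h).
  by rewrite cylQ; case: ifP.
have mQy h : measurable ([set w | [/\ Q (fun s => X s w), X t w = x & X t.+1 w = y]] `&` cyl h).
  have -> : [set w | [/\ Q (fun s => X s w), X t w = x & X t.+1 w = y]] `&` cyl h =
      [set w | Q (fun s => X s w) /\ X t w = x] `&` cyl h `&` [set w | X t.+1 w = y].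
    by apply/seteqP; split=> w [] /= [] => [? ? ?|[? ?] ? ?].
  exact: measurableI.
rewrite (@measure_partition _ prefix); last by move=> h; rewrite preE.
rewrite [in RHS](@measure_partition _ prefix); last by move=> h; rewrite preE.
rewrite ge0_sume_distrl; last by move=> h _; exact: measure_ge0.
apply: eq_bigr => h _; rewrite !preE cylQ.
have -> : [set w | [/\ Q (fun s => X s w), X t w = x & X t.+1 w = y]] `&` cyl h =
      [set w | Q (fun s => X s w) /\ X t w = x] `&` cyl h `&` [set w | X t.+1 w = y].
  by apply/seteqP; split=> w [] /= [] => [? ? ?|[? ?] ? ?].
rewrite cylQ; case: asboolP => [[_ <-]|_]; last by rewrite set0I measure0 mul0e.
exact: (markov t (path h) y).
Qed.

End FiniteExpectation.

(** * The law of the history *)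

Section SigmaAlgebra.
Context (d : measure_display) (T : measurableType d).

Lemma salgebra_of_gen (J E : Type) (Y : J -> T -> E) j e :
  salgebra_of Y [set w | Y j w = e].
Proof. by apply: sub_sigma_algebra; exists j, e. Qed.

Lemma salgebra_of_bigcap (J E : Type) (Y : J -> T -> E) (A : nat -> set T) :
  (forall s, salgebra_of Y (A s)) -> salgebra_of Y (\bigcap_s A s).
Proof.
move=> mA; rewrite /salgebra_of.
exact: (@bigcapT_measurable _ (g_sigma_algebraType _)).
Qed.

Lemma salgebra_ofT (J E : Type) (Y : J -> T -> E) : salgebra_of Y setT.
Proof. exact: (@measurableT _ (g_sigma_algebraType _)). Qed.

Lemma salgebra_of_measurable (J E : Type) (Y : J -> T -> E) (A : set T) :
  (forall j e, measurable [set w | Y j w = e]) -> salgebra_of Y A -> measurable A.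
Proof.
move=> mY; apply: smallest_sub; first exact: sigma_algebra_measurable.
by move=> _ [j [e ->]].
Qed.
End SigmaAlgebra.

Section Run.
Context (R : realType) (d : measure_display) (T : measurableType d).
Variable Pr : probability T R.
Context (K : nat) (N : 'I_K -> nat).
Variables (P : forall i, 'M[R]_(N i)) (X : forall i, nat -> T -> 'I_(N i)).
Variable alpha : T -> policy N.
Hypothesis X_chain : forall i, markov_chain Pr (P i) (X i).
Hypothesis alpha_meas : forall h i, measurable [set w | alpha w h = i].
Hypothesis indep : mutually_independent Pr (sources X alpha).

Local Notation obs := {i : 'I_K & 'I_(N i)}.
Local Notation mkobs j x := (@Tagged _ j (fun i0 => 'I_(N i0)) x).

Definition hist (t : nat) (w : T) : history N := play (alpha w) (fun i s => X i s w) t.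

Definition hist_obs (t : nat) (w : T) : obs := mkobs _ (X (alpha w (hist t w)) t w).

Lemma histS t w : hist t.+1 w = rcons (hist t w) (hist_obs t w).
Proof. by []. Qed.

Lemma size_hist t w : size (hist t w) = t.
Proof. by elim: t => //= t IH; rewrite histS size_rcons IH. Qed.

(** The event that the player's choices agree with [h] whenever the observations
    do; unlike the event that [h] occurs, it only depends on the policy. *)
Definition plays (h : history N) : set T :=
  [set w | forall s o, onth h s = Some o -> alpha w (take s h) = tag o].

(** The event that arm [j] shows the states recorded in [h] at the times when [h]
    plays it; it only depends on arm [j]. *)
Definition shows (h : history N) j : set T :=
  [set w | forall s (x : 'I_(N j)), onth h s = Some (mkobs j x) -> X j s w = x].

Lemma onth_rcons_lt (h : history N) o s : (s < size h)%N -> onth (rcons h o) s = onth h s.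
Proof. by move=> sh; rewrite -cats1 onth_cat sh. Qed.

Lemma onth_rcons_size (h : history N) o : onth (rcons h o) (size h) = Some o.
Proof. by rewrite -cats1 onth_cat ltnn subnn. Qed.

Lemma onth_rcons_gt (h : history N) o s : (size h < s)%N -> onth (rcons h o) s = None.
Proof. by move=> sh; apply: onth_default; rewrite size_rcons. Qed.

Lemma onth_rconsP (h : history N) o s o' : onth (rcons h o) s = Some o' ->
  (s < size h)%N /\ onth h s = Some o' \/ s = size h /\ o = o'.
Proof.
case: (ltngtP s (size h)) => sh.
- by rewrite onth_rcons_lt //; left.
- by rewrite onth_rcons_gt.
- by rewrite sh onth_rcons_size => -[->]; right.
Qed.

(** The factorization that makes the independence of the arms and of the policy
    usable: a history occurs if and only if all sources agree with it. *)
Lemma histE h w :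
  hist (size h) w = h <-> plays h w /\ forall j, shows h j w.
Proof.
elim/last_ind: h => [|h o IH].
  by split=> // _; split=> [s o|j s x]; rewrite onth0n.
rewrite size_rcons histS; split.
  move=> /rcons_inj [hh oE]; have [ph sh] := IH.1 hh.
  split=> [s o'|j s x] /onth_rconsP [[lts hs]|[-> eo]].
  - by rewrite -cats1 takel_cat ?(ltnW lts) //; exact: ph.
  - by rewrite -cats1 take_size_cat // -eo -oE /hist_obs /= hh.
  - exact: sh.
  - move: oE; rewrite eo /hist_obs hh => oE.
    have := oE; move=> /(congr1 (@tag _ _)) /= aj; move: oE; rewrite aj.
    by move/eqP; rewrite eq_Tagged => /eqP.
move=> [pr sr].
have hh : hist (size h) w = h.
  apply/IH; split=> [s o' hs|j s x hs].
    have lts : (s < size h)%N by rewrite ltnNge; apply/negP => /onth_default; rewrite hs.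
    have := pr s o'; rewrite onth_rcons_lt // hs -cats1 takel_cat ?(ltnW lts) //; exact.
  have lts : (s < size h)%N by rewrite ltnNge; apply/negP => /onth_default; rewrite hs.
  by apply: sr; rewrite onth_rcons_lt.
rewrite hh; congr rcons; rewrite /hist_obs hh.
have -> : alpha w h = tag o.
  by rewrite -(pr (size h) o) ?onth_rcons_size -?cats1 ?take_size_cat.
case: o sr {pr} => i x sr /=.
by congr existT; apply: sr; rewrite onth_rcons_size.
Qed.

Lemma plays_salgebra h : sources X alpha None (plays h).
Proof.
rewrite /sources.
have -> : plays h = \bigcap_s
    [set w | forall o, onth h s = Some o -> alpha w (take s h) = tag o].
  by apply/seteqP; split=> w H s; [move=> _ o; exact: H|exact: H].
apply: salgebra_of_bigcap => s; case: (onth h s) => [q| ].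
  have -> : [set w | forall o0, Some q = Some o0 -> alpha w (take s h) = tag o0] =
            [set w | alpha w (take s h) = tag q].
    by apply/seteqP; split=> w /=; [move=> /(_ q erefl)|move=> H _ [<-]].
  exact: (@salgebra_of_gen _ _ _ _ (fun (h : history N) w => alpha w h)).

rewrite (_ : mkset _ = setT); first exact: salgebra_ofT.
by apply/seteqP; split.
Qed.

Lemma shows_salgebra h j : sources X alpha (Some j) (shows h j).
Proof.
rewrite /sources.
have -> : shows h j = \bigcap_s
    [set w | forall x, onth h s = Some (mkobs j x) -> X j s w = x].
  by apply/seteqP; split=> w H s; [move=> _ o; exact: H|exact: H].
apply: salgebra_of_bigcap => s.
have [[x hx]|nx] := pselect (exists x, onth h s = Some (mkobs j x)).
  rewrite hx (_ : mkset _ = [set w | X j s w = x]); first exact: salgebra_of_gen.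
  apply/seteqP; split=> w /=; first exact.
  by move=> Xw x' [] /eqP; rewrite eq_Tagged /= => /eqP <-.
rewrite (_ : mkset _ = setT); first exact: salgebra_ofT.
by apply/seteqP; split=> // w _ x hx; case: nx; exists x.
Qed.

Lemma hist_measurable h : measurable [set w | hist (size h) w = h].
Proof.
have -> : [set w | hist (size h) w = h] = plays h `&` \bigcap_j shows h j.
  apply/seteqP; split=> w /=.
    by move=> /histE [? sh]; split=> // j _; exact: sh.
  by move=> [? sh]; apply/histE; split=> // j; exact: sh.
apply: measurableI.
  by apply: salgebra_of_measurable (plays_salgebra h).
apply: fin_bigcap_measurable => // j _.
apply: (@salgebra_of_measurable _ _ _ _ (X j)); last exact: shows_salgebra.
by have [] := X_chain j.
Qed.

(** The choices and the states may come from different lists: appending a record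
    to [h2] only adds an observation of an arm, which the player need not
    make. *)
Lemma Pr_consistent (h1 h2 : history N) :
  Pr (plays h1 `&` \bigcap_j shows h2 j) = (Pr (plays h1) * \prod_j Pr (shows h2 j))%E.
Proof.
pose A o := if o is Some j then shows h2 j else plays h1.
have := indep (A := A); rewrite (bigD1 None) //=.
have -> : \bigcap_i A i = plays h1 `&` \bigcap_j shows h2 j.
  apply/seteqP; split=> w.
    by move=> H; split=> [|j _]; [exact: (H None)|exact: (H (Some j))].
  by move=> [H1 H2] [j | ] _ //; exact: H2.
move=> ->; last first.
  by case=> [j | ]; [exact: shows_salgebra|exact: plays_salgebra].
congr (_ * _)%E; rewrite (reindex_omap Some id) /=.
  by apply: eq_bigl => j; rewrite eqxx.
by case.
Qed.

Lemma shows_step h o y :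
  Pr (shows (rcons (rcons h o) (mkobs (tag o) y)) (tag o)) =
  (Pr (shows (rcons h o) (tag o)) * (P (tag o) (tagged o) y)%:E)%E.
Proof.
case: o y => i x y /=.
pose Q (f : nat -> 'I_(N i)) :=
  forall s (x : 'I_(N i)), onth h s = Some (mkobs i x) -> f s = x.
have := @markov_chain_step _ _ _ Pr _ (P i) (X i) (size h) Q x y (X_chain i).
have mkobs_inj (a b : 'I_(N i)) : mkobs i a = mkobs i b -> a = b.
  by move/eqP; rewrite eq_Tagged => /eqP.
have lts s v : onth h s = Some v -> (s < size h)%N.
  by move=> hs; rewrite ltnNge; apply/negP => /onth_default; rewrite hs.
rewrite (_ : [set w | [/\ _, _ & _]] =
    shows (rcons (rcons h (mkobs i x)) (mkobs i y)) i); last first.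
  apply/seteqP; split=> w /=; last first.
    move=> H; split=> [s v hs| |].
    + apply: H; have ls := lts _ _ hs.
      by rewrite onth_rcons_lt ?size_rcons ?ltnS ?(ltnW ls) // onth_rcons_lt.
    + by apply: H; rewrite onth_rcons_lt ?size_rcons // onth_rcons_size.
    + by apply: H; rewrite -(size_rcons h (mkobs i x)) onth_rcons_size.
  move=> [HQ Hx Hy] s v /onth_rconsP [[_ /onth_rconsP [[_ hs]|[-> /mkobs_inj <-]]]|].
  + exact: HQ.
  + by [].
  + by rewrite size_rcons => -[-> /mkobs_inj <-].
rewrite (_ : [set w | _ /\ _] = shows (rcons h (mkobs i x)) i); last first.
  apply/seteqP; split=> w /=; last first.
    move=> H; split=> [s v hs|].
    + by apply: H; rewrite onth_rcons_lt // (lts _ _ hs).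
    + by apply: H; rewrite onth_rcons_size.
  by move=> [HQ Hx] s v /onth_rconsP [[_ /HQ]|[-> /mkobs_inj <-]].
apply=> f g fg Qf s v hs; rewrite -fg; first exact: Qf.
exact/ltnW/lts/hs.
Qed.

Lemma shows_other h o j : j != tag o -> shows (rcons h o) j = shows h j.
Proof.
move=> jo; apply/seteqP; split=> w H s v hs.
  have ls : (s < size h)%N by rewrite ltnNge; apply/negP => /onth_default; rewrite hs.
  by apply: H; rewrite onth_rcons_lt.
case: (onth_rconsP hs) => [[_ /H]//|[_ ov]].
by move: jo; rewrite ov eqxx.
Qed.

Lemma mkobs_transport (F : forall j, 'I_(N j) -> Prop) j k x v :
  mkobs j x = mkobs k v -> F j x -> F k v.
Proof.
by move=> E; rewrite -[F k v]/(F (tag (mkobs k v)) (tagged (mkobs k v))) -E.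
Qed.

(** The Markov property along a run: only the factor of the arm just played is
    affected by its next state. *)
Lemma hist_next (h : history N) (o : obs) y :
  Pr [set w | hist (size h).+1 w = rcons h o /\ X (tag o) (size h).+1 w = y] =
  (Pr [set w | hist (size h).+1 w = rcons h o] * (P (tag o) (tagged o) y)%:E)%E.
Proof.
pose h' := rcons h o; pose h'' := rcons h' (mkobs (tag o) y).
have sz : (size h).+1 = size h' by rewrite size_rcons.
rewrite sz -/h'.
rewrite (_ : [set w | _ /\ _] = plays h' `&` \bigcap_j shows h'' j); last first.
  apply/seteqP; split=> w /=.
    move=> [/histE [pw sw] Xy]; split=> // j _ s v /onth_rconsP [[_ /sw]//|[-> ]].
    move=> E.
    exact: (mkobs_transport (F := fun j v => X j (size h') w = v) E Xy).
  move=> [pw sw]; split.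
    apply/histE; split=> // j s v hs.
    have ls : (s < size h')%N by rewrite ltnNge; apply/negP => /onth_default; rewrite hs.
    by apply: (sw j I); rewrite onth_rcons_lt.
  by apply: (sw (tag o) I); rewrite onth_rcons_size.
rewrite (_ : [set w | _ = _] = plays h' `&` \bigcap_j shows h' j); last first.
  apply/seteqP; split=> w /=.
    by move=> /histE [? sh]; split=> // j _; exact: sh.
  by move=> [? sh]; apply/histE; split=> // j; exact: sh.
rewrite !Pr_consistent -muleA; congr (_ * _)%E.
rewrite (bigD1 (tag o)) //= [in RHS](bigD1 (tag o)) //= shows_step -!muleA.
congr (_ * _)%E; rewrite muleC; congr (_ * _)%E.
by apply: eq_bigr => j jo; rewrite shows_other.
Qed.

(** Every expectation below has this form, so that the properties of [slot_mean]
    are all that is used of the probability space. *)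
Definition slot_mean (t : nat)
    (G : history N -> (forall i, 'I_(N i)) -> 'I_K -> R) : R :=
  fine ('E_Pr[fun w => G (hist t w) (fun i => X i t w) (alpha w (hist t w))])%E.

Let slot_type t := (t.-tuple obs * {dffun forall i : 'I_K, 'I_(N i)} * 'I_K)%type.

Let histT t w : t.-tuple obs := Tuple (introT eqP (size_hist t w)).

Let slot t w : slot_type t :=
  (histT t w, finfun (fun i => X i t w), alpha w (hist t w)).

Let slot_fun t (G : history N -> (forall i, 'I_(N i)) -> 'I_K -> R) (z : slot_type t) : R :=
  G z.1.1 z.1.2 z.2.

Let slot_funE t G w : slot_fun G (slot t w) = G (hist t w) (fun i => X i t w) (alpha w (hist t w)).
Proof.
by rewrite /slot_fun /=; congr (G _ _ _); apply: functional_extensionality_dep => i; rewrite ffunE.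
Qed.

Let histT_measurable t (h : t.-tuple obs) : measurable [set w | histT t w = h].
Proof.
rewrite (_ : mkset _ = [set w | hist (size (h : history N)) w = h]).
  exact: hist_measurable.
apply/seteqP; split=> w /=; rewrite size_tuple.
  by move=> <-.
by move=> E; apply: val_inj.
Qed.

Let slot_measurable t z : measurable [set w | slot t w = z].
Proof.
case: z => [[h x] i].
rewrite (_ : mkset _ = [set w | histT t w = h] `&`
   (\bigcap_j [set w | X j t w = x j]) `&` [set w | alpha w h = i]).
  apply: measurableI; last exact: alpha_meas.
  apply: measurableI; first exact: histT_measurable.
  by apply: fin_bigcap_measurable => // j _; have [] := X_chain j.
apply/seteqP; split=> w /=.
  by move=> [<- <- <-]; split=> //; split=> // j _; rewrite ffunE.
move=> [[<- Hx] <-]; congr (_, _, _); apply/ffunP => j; rewrite ffunE; exact: Hx.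
Qed.

Lemma slot_expectation t G :
  ('E_Pr[fun w => G (hist t w) (fun i => X i t w) (alpha w (hist t w))] = (slot_mean t G)%:E)%E.
Proof.
rewrite /slot_mean.
under [in LHS]eq_fun do rewrite -slot_funE.
under [in RHS]eq_fun do rewrite -slot_funE.
by rewrite (expectation_finite Pr (slot_fun G) (@slot_measurable t)).
Qed.

Let slot_meanE t G :
  slot_mean t G = \sum_z slot_fun G z * fine (Pr [set w | slot t w = z]).
Proof.
rewrite /slot_mean; under eq_fun do rewrite -slot_funE.
by rewrite (expectation_finite Pr (slot_fun G) (@slot_measurable t)).
Qed.

Lemma slot_meanD t G H :
  slot_mean t (fun h x i => G h x i + H h x i) = slot_mean t G + slot_mean t H.
Proof.
by rewrite !slot_meanE -big_split /=; apply: eq_bigr => z _; rewrite -mulrDl.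
Qed.

Lemma slot_meanZ t c G :
  slot_mean t (fun h x i => c * G h x i) = c * slot_mean t G.
Proof.
by rewrite !slot_meanE mulr_sumr; apply: eq_bigr => z _; rewrite mulrA.
Qed.

Lemma slot_mean_cst t c : slot_mean t (fun _ _ _ => c) = c.
Proof.
rewrite /slot_mean unlock (integral_cst Pr measurableT c%:E).
by rewrite [X in (_ * X)%E](@probability_setT _ _ _ Pr) mule1.
Qed.

Lemma slot_mean_le t G H :
  (forall w, G (hist t w) (fun i => X i t w) (alpha w (hist t w)) <=
             H (hist t w) (fun i => X i t w) (alpha w (hist t w))) ->
  slot_mean t G <= slot_mean t H.
Proof.
move=> GH; rewrite !slot_meanE; apply: ler_sum => z _.
have [[w <-]|nz] := pselect (exists w, slot t w = z).
  by rewrite !slot_funE ler_wpM2r // fine_ge0.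
rewrite (_ : mkset _ = set0) ?measure0 ?mulr0 //.
by apply/seteqP; split=> // w wz; apply: nz; exists w.
Qed.

(** One step of the run for functions [G] that depend, among the current states,
    only on that of the last arm played. The potentials are of this kind, and so
    the states that the history does not record need not be conditioned upon. *)
Lemma slot_mean_step t (G : history N -> (forall i, 'I_(N i)) -> R) :
  (forall h o (x x' : forall i, 'I_(N i)), x (tag o) = x' (tag o) -> G (rcons h o) x = G (rcons h o) x') ->
  slot_mean t.+1 (fun h x _ => G h x) =
  slot_mean t (fun h x i =>
    \sum_y P i (x i) y * G (rcons h (mkobs i (x i))) (dfwith x i y)).
Proof.
move=> locG.
pose J : finType := (t.-tuple obs * {o : obs & 'I_(N (tag o))})%type.
pose J' : finType := (t.-tuple obs * obs)%type.
pose mkJ (h : t.-tuple obs) (o : obs) (y : 'I_(N (tag o))) : J :=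
  (h, @Tagged _ o (fun o : obs => 'I_(N (tag o))) y).
pose Z w : J := mkJ (histT t w) (hist_obs t w) (X (tag (hist_obs t w)) t.+1 w).
pose Z' w : J' := (histT t w, hist_obs t w).
(* Arbitrary states for the arms that do not affect the value of G. *)
have [w0 _] : exists w : T, True by exists point.
pose x0 i := X i t w0.
pose g (z : J) := G (rcons z.1 (tag z.2)) (dfwith x0 (tag (tag z.2)) (tagged z.2)).
pose g' (z : J') := \sum_y P (tag z.2) (tagged z.2) y * g (mkJ z.1 z.2 y).
have mZ' z : measurable [set w | Z' w = z].
  case: z => h o; rewrite (_ : mkset _ = [set w | hist (size (rcons h o)) w = rcons h o]).
    exact: hist_measurable.
  apply/seteqP; split=> w; rewrite /= size_rcons size_tuple /Z' histS.
    by move=> [<- <-].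
  by move=> /rcons_inj [hh ->]; congr (_, _); apply: val_inj.
have ZE h o y : [set w | Z w = mkJ h o y] =
    [set w | hist t.+1 w = rcons h o /\ X (tag o) t.+1 w = y].
  apply/seteqP; split=> w /=.
    move=> E; rewrite histS -[tval h]/(tval (mkJ h o y).1) -[(o)]/(tag (mkJ h o y).2).
    rewrite -{1 2}E; split=> //.
    pose F (z : J) := X (tag (tag z.2)) t.+1 w = tagged z.2.
    by rewrite -[X _ _ _ = _]/(F (mkJ h o y)) -E.
  rewrite histS => -[/rcons_inj [hh oE] <-]; rewrite /Z oE.
  by have -> : histT t w = h by exact: val_inj.
have mZ z : measurable [set w | Z w = z].
  case: z => h [q y]; rewrite -/(mkJ h q y) ZE.
  rewrite (_ : mkset _ = [set w | hist (size (rcons h q)) w = rcons h q] `&` [set w | X (tag q) t.+1 w = y]).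
    by apply: measurableI; [exact: hist_measurable|have [] := X_chain (tag q)].
  by rewrite size_rcons size_tuple.
transitivity (fine ('E_Pr[fun w => g (Z w)])%E).
  rewrite /slot_mean; congr (fine (expectation _ _)); apply/funext => w.
  rewrite /g histS /=; apply: locG; rewrite dfwithin //.
transitivity (fine ('E_Pr[fun w => g' (Z' w)])%E); last first.
  rewrite /slot_mean; congr (fine (expectation _ _)); apply/funext => w.
  rewrite /g' /=; apply: eq_bigr => y _; congr (_ * _).
  by apply: locG => /=; rewrite !dfwithin.
rewrite (expectation_finite Pr g mZ) (expectation_finite Pr g' mZ') /=.
have sumJ (F : J -> R) : \sum_z F z = \sum_h \sum_o \sum_y F (mkJ h o y).
  rewrite (eq_bigr (fun z => F (z.1, z.2))); last by case.
  rewrite -(pair_bigA _ (fun h u => F (h, u))) /=; apply: eq_bigr => h _.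
  rewrite (sig_big_dep (fun o : obs => true) (fun o y => true) (fun o y => F (mkJ h o y))) /=.
  by apply: eq_bigr => -[].
rewrite sumJ (eq_bigr (fun z => g' (z.1, z.2) * fine (Pr [set w | Z' w = (z.1, z.2)]))); last by case.
rewrite -(pair_bigA _ (fun h o => g' (h, o) * fine (Pr [set w | Z' w = (h, o)]))) /=.
apply: eq_bigr => h _; apply: eq_bigr => o _.
rewrite /g' mulr_suml; apply: eq_bigr => y _ /=.
rewrite ZE -[t in hist t.+1](size_tuple h) -[t in X _ t.+1](size_tuple h) hist_next.
rewrite fineM ?fin_num_measure //; last first.
  have := hist_measurable (rcons h o); rewrite size_rcons; exact.
rewrite /= [P _ _ _ * _]mulrC -mulrA; congr (_ * _); rewrite mulrC; congr (_ * fine (Pr _)).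
apply/seteqP; split=> w; rewrite /= size_tuple /Z' histS.
  by move=> /rcons_inj [hh ->]; congr (_, _); apply: val_inj.
by move=> [<- <-].
Qed.

End Run.

(** * Blocks and samples of a run of the algorithm *)

Section RCA.
Context (R : realType) (K : nat) (N : 'I_K -> nat).
Variables (r : forall i, 'I_(N i) -> R) (L : R).
Local Notation obs := {i : 'I_K & 'I_(N i)}.
Local Notation state := (rca_state R N).
Implicit Types (h : history N) (s : state) (q : obs) (i j : 'I_K).

Definition rca_choice h i : Prop :=
  let s := rca_run r h in
  match ph s with
  | Before j | Within j => i = j
  | Between =>
      if (nblocks s < K)%N then i = nblocks s :> nat
      else forall j, rca_index L s j <= rca_index L s i
  end.

Inductive rca_history : history N -> Prop :=
| rca_history_nil : rca_history [::]
| rca_history_rcons h q :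
    rca_history h -> rca_choice h (tag q) -> rca_history (rcons h q).

Definition is_between (p : phase K) := if p is Between then true else false.
Definition is_within (p : phase K) := if p is Within _ then true else false.
Definition is_before j (p : phase K) := if p is Before i then i == j else false.
Definition current (p : phase K) : option 'I_K :=
  match p with Between => None | Before i | Within i => Some i end.

(** An arm without a regenerative state takes the state it shows as such, which
    counts as a visit. *)
Definition visits s q := if regen s (tag q) is Some g then tagged q == g else true.
Definition in_sb2 s q := is_within (ph s) (+) visits s q.

Definition next_phase s q : phase K :=
  if visits s q then (if is_within (ph s) then @Between K else Within (tag q))
  else (if is_within (ph s) then Within (tag q) else Before (tag q)).

(** A uniform description of a step: an SB2 slot is one that either begins SB2 by
    a visit or continues it without one. *)
Lemma rca_stepE s q : let s' := rca_step r s q in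
  [/\ ph s' = next_phase s q,
      nblocks s' = (nblocks s + (is_within (ph s) && visits s q))%N,
      regen s' = (if in_sb2 s q && ~~ is_within (ph s)
                  then dfwith (regen s) (tag q) (Some (tagged q)) else regen s),
      forall j, slots2 s' j = (slots2 s j + (in_sb2 s q && (tag q == j)))%N &
      forall j, rewards2 s' j = rewards2 s j + (if in_sb2 s q && (tag q == j) then r (tagged q) else 0)].
Proof.
rewrite /= /rca_step /next_phase /in_sb2 -/(visits s q).
case: (ph s) => [|i|i] /=; case: (visits s q) => /=; split=> //=; rewrite ?addn0 ?addn1 //.
all: by move=> j; rewrite 1?eq_sym ?addn0 ?addr0.
Qed.

Definition slots h : seq (state * obs) :=
  (foldl (fun u q => (rca_step r u.1 q, rcons u.2 (u.1, q))) (rca_init R N, [::]) h).2.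

Lemma slots_rcons h q : slots (rcons h q) = rcons (slots h) (rca_run r h, q).
Proof.
rewrite /slots foldl_rcons /=; congr (rcons _ (_, _)).
elim/last_ind: h => // h q' IH.
by rewrite foldl_rcons /= IH /rca_run foldl_rcons.
Qed.

Lemma rca_run_rcons h q : rca_run r (rcons h q) = rca_step r (rca_run r h) q.
Proof. by rewrite /rca_run foldl_rcons. Qed.

Definition block_count j h : nat :=
  count (fun u => is_between (ph u.1) && (tag u.2 == j)) (slots h).

Definition samples j h : seq obs :=
  [seq u.2 | u <- slots h & in_sb2 u.1 u.2 && (tag u.2 == j)].

Lemma block_count_rcons j h q : block_count j (rcons h q) =
  (block_count j h + (is_between (ph (rca_run r h)) && (tag q == j)))%N.
Proof. by rewrite /block_count slots_rcons -cats1 count_cat /= addn0. Qed.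

Lemma samples_rcons j h q : samples j (rcons h q) =
  samples j h ++ (if in_sb2 (rca_run r h) q && (tag q == j) then [:: q] else [::]).
Proof.
rewrite /samples slots_rcons -cats1 filter_cat map_cat /=.
by case: ifP.
Qed.

Lemma samples_tag j h q : q \in samples j h -> tag q = j.
Proof.
elim/last_ind: h => // h q' IH; rewrite samples_rcons mem_cat => /orP[/IH //|].
by case: ifP => // /andP[_ /eqP qj]; rewrite inE => /eqP ->.
Qed.

Lemma slots2_samples j h : slots2 (rca_run r h) j = size (samples j h).
Proof.
elim/last_ind: h => // h q IH; rewrite rca_run_rcons samples_rcons size_cat.
by have [_ _ _ -> _] := rca_stepE (rca_run r h) q; rewrite IH; case: ifP.
Qed.

Lemma rewards2_samples j h :
  rewards2 (rca_run r h) j = \sum_(q <- samples j h) r (tagged q).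
Proof.
elim/last_ind: h => [|h q IH]; first by rewrite big_nil.
rewrite rca_run_rcons samples_rcons big_cat /=.
have [_ _ _ _ ->] := rca_stepE (rca_run r h) q; rewrite IH; congr (_ + _).
by case: ifP => _; rewrite ?big_seq1 ?big_nil.
Qed.

Definition last_arm h : option 'I_K := last None [seq Some (tag q) | q <- h].

Lemma last_arm_rcons h q : last_arm (rcons h q) = Some (tag q).
Proof. by rewrite /last_arm map_rcons last_rcons. Qed.

Definition sb2_total h := (\sum_j slots2 (rca_run r h) j)%N.

Lemma sb2_total_rcons h q :
  sb2_total (rcons h q) = (sb2_total h + in_sb2 (rca_run r h) q)%N.
Proof.
rewrite /sb2_total rca_run_rcons.
have [_ _ _ H _] := rca_stepE (rca_run r h) q.
under eq_bigr do rewrite H; rewrite big_split /=; congr (_ + _)%N.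
rewrite (bigD1 (tag q)) //= eqxx andbT big1 ?addn0 // => j jq.
by rewrite eq_sym (negPf jq) andbF.
Qed.

Lemma sb2_total_size h : (sb2_total h <= size h)%N.
Proof.
elim/last_ind: h => [|h q IH]; first by rewrite /sb2_total big1.
by rewrite sb2_total_rcons size_rcons; case: in_sb2; lia.
Qed.

(** The last part of the first clause and the fourth clause say that no arm is
    played ahead of its turn in the initial blocks. A block counts as soon as it starts,
    hence the correction in the last clause while its SB1 part lasts. *)
Definition rca_invariant h := let s := rca_run r h in
  [/\ forall i, current (ph s) = Some i ->
        [/\ regen s i <> None, last_arm h = Some i &
            (nblocks s < K)%N -> i = nblocks s :> nat],
      forall j, (j < nblocks s)%N -> (0 < slots2 s j)%N,
      forall i, ph s = Within i -> (0 < slots2 s i)%N,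
      forall j, (nblocks s <= j)%N -> current (ph s) <> Some j -> block_count j h = 0%N &
      forall j, (block_count j h <= slots2 s j + is_before j (ph s))%N].

Lemma rca_historyI h : rca_history h -> rca_invariant h.
Proof.
elim=> [|{}h q _ IH C]; first by split.
move: IH C; rewrite /rca_invariant /rca_choice rca_run_rcons /=.
have [phE nbE rgE s2E _] := rca_stepE (rca_run r h) q.
set s := rca_run r h in phE nbE rgE s2E *.
set s' := rca_step r s q in phE nbE rgE s2E *.
move=> [I1 I2 I3 I4 I5] C.
have cur i : current (ph s) = Some i -> tag q = i.
  by case: (ph s) C => //= j -> [].
have initial : (nblocks s < K)%N -> tag q = nblocks s :> nat.
  move=> ltK; case E: (current (ph s)) => [i|].
    by rewrite (cur _ E); have [_ _ ->] := I1 _ E.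
  by move: C E; case: (ph s) => //=; rewrite ltK.
split.
- move=> i; rewrite phE /next_phase => Ei.
  have Et : tag q = i by move: Ei; do 2 case: ifP => _ //=; case.
  subst i; rewrite last_arm_rcons; split=> //.
    have novisit : visits s q = false -> regen s (tag q) <> None.
      by rewrite /visits; case: (regen s (tag q)).
    rewrite rgE /in_sb2; move: Ei; case: (visits s q) novisit; case: (is_within _) => //=.
    - by move=> _ _; rewrite dfwithin.
    - by move=> H _; apply: H.
    - by move=> H _; apply: H.
  by rewrite nbE; move: Ei; do 2 case: ifP => ? //=; rewrite addn0.
- move=> j; rewrite nbE s2E => jn.
  have [/I2|jnb] := ltnP j (nblocks s); first by move=> ?; rewrite ltn_addr.
  have [wv|nwv] := boolP (is_within (ph s) && visits s q); last first.
    by move: jn; rewrite (negPf nwv) addn0 ltnNge jnb.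
  move: jn; rewrite wv addn1 ltnS => jnb'.
  have jE : j = nblocks s :> nat by apply/eqP; rewrite eqn_leq jnb jnb'.
  move: wv; case E : (ph s) => [|//|i] //= _.
  have Et : tag q = i by apply: cur; rewrite E.
  suff -> : j = i by rewrite ltn_addr // I3.
  by apply: val_inj; rewrite /= jE -Et initial // -jE ltn_ord.
- move=> i; rewrite phE s2E /next_phase /in_sb2.
  by case: ifP => /= _; case W: (is_within (ph s)) => //= -[<-]; rewrite eqxx addn1.
- move=> j; rewrite nbE phE block_count_rcons -/s => nj curj.
  have nj0 : (nblocks s <= j)%N by apply: leq_trans nj; rewrite leq_addr.
  have [tj|tj] := eqVneq (tag q) j.
    have nbK : (nblocks s < K)%N by apply: leq_ltn_trans nj0 (ltn_ord j).
    move: nj curj; rewrite /next_phase tj.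
    case: (visits s q); case: (is_within _) => //=; rewrite -tj (initial nbK).
    by rewrite addn1 ltnn.
  rewrite andbF addn0; apply: I4 => // E; move: tj; rewrite (cur _ E) eqxx //.
- move=> j; rewrite block_count_rcons -/s phE s2E; have := I5 j.
  rewrite /next_phase /in_sb2.
  have := cur; case: (ph s) => [_|i0 /(_ _ erefl) <-|i0 /(_ _ erefl) <-] /=; case: (visits s q) => /=; case: (tag q == j) => /=; lia.
Qed.

(** When [i] is selected with at least [l] samples, the charge
    [bad (sb2_total h) h] is positive; the total number of samples increases
    during the block, so that the next selection makes a charge at a larger time.
    The upper limit in the induction includes the current total exactly while a
    block of [i] is in SB1, when its charge has been made but no sample added. *)
Lemma block_count_le (i : 'I_K) (l n : nat) (bad : nat -> history N -> nat) h :
  (0 < l)%N ->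
  (forall t h q, (bad t h <= bad t (rcons h q))%N) ->
  (forall h, rca_history h -> is_between (ph (rca_run r h)) ->
     (K <= nblocks (rca_run r h))%N -> rca_choice h i ->
     (l <= slots2 (rca_run r h) i)%N -> (size h <= n)%N ->
     (0 < bad (sb2_total h) h)%N) ->
  rca_history h -> (size h <= n)%N ->
  (block_count i h <= l + \sum_(1 <= t < n.+1) bad t h)%N.
Proof.
move=> l_gt0 bad_mono badP.
suff main : rca_history h -> (size h <= n)%N ->
    (block_count i h <= l + \sum_(1 <= t < sb2_total h + (is_before i (ph (rca_run r h)))) bad t h)%N.
  move=> Hh hn; apply: leq_trans (main Hh hn) _; rewrite leq_add2l.
  have b1 : (is_before i (ph (rca_run r h)) <= 1)%N by case: is_before.
  have := sb2_total_size h => szh.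
  have [le1|gt1] := leqP (sb2_total h + is_before i (ph (rca_run r h))) 1.
    by rewrite big_geq.
  rewrite [leqRHS](@big_cat_nat _ _ _ (sb2_total h + is_before i (ph (rca_run r h)))) /=.
  - by rewrite leq_addr.
  - exact: ltnW.
  - by lia.
elim=> [_|{}h q Hh IH C]; first by rewrite leq_addr.
rewrite size_rcons => hn; have {}IH := IH (ltnW hn).
have := rca_historyI Hh; rewrite /rca_invariant.
move: IH C; rewrite block_count_rcons rca_run_rcons sb2_total_rcons.
have [-> _ _ _ _] := rca_stepE (rca_run r h) q.
have := badP h Hh; rewrite /rca_choice.
set s := rca_run r h; move=> bad1 IH C [I1 I2 I3 I4 I5].
have sum_mono a b : (a <= b)%N ->
   (\sum_(1 <= t < a) bad t h <= \sum_(1 <= t < b) bad t (rcons h q))%N.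
  move=> ab; have [a1|a1] := leqP a 1; first by rewrite big_geq.
  rewrite [leqRHS](@big_cat_nat _ _ _ a) //=; last exact: ltnW.
  by apply: leq_trans (leq_addr _ _); apply: leq_sum.
have [st|nst] := boolP (is_between (ph s) && (tag q == i)); last first.
  rewrite addn0; apply: leq_trans IH _; rewrite leq_add2l; apply: sum_mono.
  rewrite /next_phase /in_sb2; move: C nst.
  by case: (ph s) => [|i0|i0] /=; case: (visits s q) => //=; try move=> <-;
    case: (tag q == i) => //=; lia.
move: st => /andP[bet /eqP tq].
have E : ph s = Between K by case: (ph s) bet.
rewrite E in C; rewrite E /= addn0 in IH.
have upto : (sb2_total h + in_sb2 s q + is_before i (next_phase s q) = (sb2_total h).+1)%N.
  by rewrite /in_sb2 /next_phase E /=; case: visits; rewrite /= ?tq ?eqxx; lia.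
rewrite upto.
have [bcl|lbc] := ltnP (block_count i h) l.
  by apply: leq_trans (leq_addr _ _); rewrite addn1.
have bc_gt0 : (0 < block_count i h)%N by apply: leq_trans lbc.
have slots_i : (block_count i h <= slots2 s i)%N by have := I5 i; rewrite E addn0.
have sb2_gt0 : (0 < sb2_total h)%N.
  rewrite /sb2_total (bigD1 i) //=; apply: leq_trans (leq_addr _ _).
  exact: leq_trans slots_i.
have hasbad : (0 < bad (sb2_total h) h)%N.
  apply: bad1 => //.
  - rewrite leqNgt; apply/negP => nbK; rewrite nbK tq in C.
    by move: bc_gt0; rewrite I4 ?C // E.
  - by rewrite E -tq.
  - exact: leq_trans slots_i.
  - exact: ltnW.
rewrite big_nat_recr //= addnA; apply: leq_add.
  by apply: leq_trans IH _; rewrite leq_add2l; exact: sum_mono.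
by apply: leq_trans hasbad _.
Qed.

End RCA.

(** * The regret potential *)

Section RegretPotential.
Context (R : realType) (K : nat) (N : 'I_K -> nat).
Variables (r : forall i, 'I_(N i) -> R) (L : R).
Variables (P : forall i, 'M[R]_(N i)) (p : forall i, 'I_(N i) -> R) (star : 'I_K).
Local Notation obs := {i : 'I_K & 'I_(N i)}.
Local Notation mkobs j x := (@Tagged _ j (fun i0 => 'I_(N i0)) x).
Variables (mu M pm : 'I_K -> R) (gam : forall i, 'I_(N i) -> R)
  (H : forall i, 'I_(N i) -> 'I_(N i) -> R).
Arguments p : clear implicits.
Arguments gam : clear implicits.
Arguments H : clear implicits.
Implicit Types (h : history N) (xs : forall i, 'I_(N i)).
Hypothesis P_ge0 : forall i x y, 0 <= P i x y.
Hypothesis P_sum : forall i x, \sum_y P i x y = 1.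
Hypothesis mu_le : forall i, mu i <= mu star.
Hypothesis p_gt0 : forall i x, 0 < p i x.
Hypothesis p_pm : forall i x, (p i x)^-1 <= pm i.
Hypothesis gam_ge0 : forall i x, 0 <= gam i x.
Hypothesis gam_le : forall i x, gam i x <= mu i * M i.
Hypothesis gam_step : forall i x, \sum_y P i x y * gam i y = gam i x - mu i + r x.
Hypothesis H_ge0 : forall i z x, 0 <= H i z x.
Hypothesis H_le : forall i z x, H i z x <= M i.
Hypothesis H_target : forall i z, H i z z = 0.
Hypothesis H_step : forall i z x,
  \sum_y P i x y * H i z y = H i z x - 1 + (x == z)%:R / p i z.

Let Delta i := mu star - mu i.

(** The corrections for the current block of a suboptimal arm: [gam] for its
    rewards, and the gap times the mean number of slots to its end, which is the
    time to reach the regenerative state, plus a return time in SB1, plus 1 for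
    SB3. *)
Definition block_potential (s : rca_state R N) xs : R :=
  match ph s with
  | Between => 0
  | Before i => if regen s i is Some z
                then gam i (xs i) + Delta i * (H i z (xs i) + (p i z)^-1 + 1) else 0
  | Within i => if regen s i is Some z
                then gam i (xs i) + Delta i * (H i z (xs i) + 1) else 0
  end.

(** The reserve [mu star * M star] bounds [gam star], so a run of the best arm can
    start at any moment; during such a run it is replaced by [gam star]. *)
Definition regret_potential h xs : R :=
  if last_arm h == Some star then gam star (xs star)
  else mu star * M star + block_potential (rca_run r h) xs.

Definition block_cost i : R :=
  if i == star then 0
  else Delta i * (pm i + M i + 1) + mu i * M i + mu star * M star.

Lemma Delta_ge0 i : 0 <= Delta i. Proof. by rewrite subr_ge0. Qed.

Lemma block_potential_ge0 s xs : 0 <= block_potential s xs.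
Proof.
have D := Delta_ge0.
rewrite /block_potential; case: (ph s) => [//|i|i]; case: (regen s i) => [z|//];
  rewrite addr_ge0 ?mulr_ge0 // ?addr_ge0 ?invr_ge0 // ltW //.
Qed.

Lemma regret_potential_ge0 h xs : 0 <= regret_potential h xs.
Proof.
rewrite /regret_potential; case: ifP => _ //; rewrite addr_ge0 ?block_potential_ge0 //.
exact: le_trans (gam_ge0 (xs star)) (gam_le (xs star)).
Qed.

(** In a block or in a run of the best arm the potential only looks at the arm
    being played. *)
Lemma regret_potential_local h (q : obs) xs xs' : xs (tag q) = xs' (tag q) ->
  regret_potential (rcons h q) xs = regret_potential (rcons h q) xs'.
Proof.
rewrite /regret_potential last_arm_rcons rca_run_rcons /block_potential.
have [-> _ _ _ _] := rca_stepE r (rca_run r h) q.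
case: q => i v /= E; case: eqVneq => [[<-]|_]; first by rewrite E.
by rewrite /next_phase /=; case: visits; case: is_within; rewrite ?E.
Qed.

Let sum_P i x c : \sum_y P i x y * c = c.
Proof. by rewrite -mulr_suml P_sum mul1r. Qed.

Let step_affine i z v a b :
  \sum_y P i v y * (a + (gam i y + Delta i * (H i z y + b))) =
  a + (gam i v - mu i + r v) + Delta i * (H i z v - 1 + (v == z)%:R / p i z + b).
Proof.
transitivity (\sum_y P i v y * a + \sum_y P i v y * gam i y
  + Delta i * (\sum_y P i v y * H i z y + \sum_y P i v y * b)).
  rewrite mulrDr !mulr_sumr -!big_split /=; apply: eq_bigr => y _; ring.
by rewrite !sum_P gam_step H_step; ring.
Qed.

(** One identity ([affine]) covers all slots of a block of a suboptimal arm: the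
    loss [mu star - r] is the gap, paid by the decrease of the mean remaining
    length, plus the drift of [gam]. At the beginning of a block the potential is
    created, within [block_cost i]; at its end [gam] is dropped. *)
Lemma regret_potential_drift h i xs : rca_history r L h -> rca_choice r L h i ->
  mu star - r (xs i) +
    \sum_y P i (xs i) y * regret_potential (rcons h (mkobs i (xs i))) (dfwith xs i y)
  <= regret_potential h xs + (if is_between (ph (rca_run r h)) then block_cost i else 0).
Proof.
move=> Hh C.
have [I1 _ _ _ _] := rca_historyI Hh.
set s := rca_run r h in I1 *.
have cur j : current (ph s) = Some j -> i = j.
  by move: C; rewrite /rca_choice -/s; case: (ph s) => //= k -> [].
have phi0 := regret_potential_ge0 h xs.
have [ist|ist] := eqVneq i star.
  subst i.
  have -> : \sum_y P star (xs star) y *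
      regret_potential (rcons h (mkobs star (xs star))) (dfwith xs star y) =
      gam star (xs star) - mu star + r (xs star).
    rewrite -gam_step; apply: eq_bigr => y _; congr (_ * _).
    by rewrite /regret_potential last_arm_rcons /= eqxx dfwithin.
  rewrite /block_cost eqxx if_same addr0.
  suff : gam star (xs star) <= regret_potential h xs by lra.
  rewrite /regret_potential; case: ifP => // _.
  apply: (le_trans (gam_le _)); rewrite lerDl; exact: block_potential_ge0.
pose q := mkobs i (xs i).
have [phE _ rgE _ _] := rca_stepE r s q.
have nextE y : regret_potential (rcons h q) (dfwith xs i y) =
    mu star * M star + block_potential (rca_step r s q) (dfwith xs i y).
  rewrite /regret_potential last_arm_rcons rca_run_rcons -/s.
  by case: eqP => // -[] /= E; rewrite E eqxx in ist.
under eq_bigr do rewrite -/q nextE.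
have D := Delta_ge0 i.
have affine z b (c := mu star * M star) :
    mu star - r (xs i) + \sum_y P i (xs i) y *
       (c + (gam i (dfwith xs i y i) + Delta i * (H i z (dfwith xs i y i) + b))) =
    c + gam i (xs i) + Delta i * (H i z (xs i) + (xs i == z)%:R / p i z + b).
  under eq_bigr do rewrite dfwithin.
  rewrite step_affine /Delta; ring.
have nobs : visits s q = if regen s i is Some z then xs i == z else true by [].
rewrite /block_potential phE rgE /next_phase /in_sb2.
have lastE j : current (ph s) = Some j -> regret_potential h xs =
    mu star * M star + block_potential s xs.
  move=> cj; rewrite /regret_potential; have [_ -> _] := I1 _ cj.
  by case: eqP => // -[] sE; move: ist; rewrite (cur _ cj) sE eqxx.
have cost : block_cost i = Delta i * (pm i + M i + 1) + mu i * M i + mu star * M star.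
  by rewrite /block_cost (negPf ist).
case E : (ph s) => [|i0|i0].
- rewrite /= cost.
  have pz (z : 'I_(N i)) : (p i z)^-1 <= pm i by exact: p_pm.
  have hz z := H_le z (xs i).
  have gz := gam_le (xs i).
  case V : (visits s q) => /=.
    under eq_bigr do rewrite dfwithin.
    rewrite affine H_target eqxx add0r.
    have := pz (xs i); have := hz (xs i); have := H_ge0 (xs i) (xs i).
    rewrite H_target div1r => h0 h1 h2.
    have : Delta i * ((p i (xs i))^-1 + 1) <= Delta i * (pm i + M i + 1).
      by rewrite ler_wpM2l //; lra.
    lra.
  move: nobs; rewrite V; case: (regen s i) => [z|//] xz.
  under eq_bigr do rewrite -addrA.
  rewrite affine -xz mul0r addr0.
  have : Delta i * (H i z (xs i) + ((p i z)^-1 + 1)) <= Delta i * (pm i + M i + 1).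
    by rewrite ler_wpM2l //; have := pz z; have := hz z; lra.
  lra.
- have ci : current (ph s) = Some i0 by rewrite E.
  rewrite (lastE _ ci) /block_potential E /= addr0.
  have ii0 := cur _ ci; subst i0.
  have [rg _ _] := I1 _ ci.
  case V : (visits s q) => /=.
    under eq_bigr do rewrite dfwithin.
    move: nobs rg; rewrite V; case: (regen s i) => [z|//] /esym /eqP <- _.
    by rewrite affine eqxx div1r H_target add0r; lra.
  move: nobs rg; rewrite V; case: (regen s i) => [z|//] xz _.
  under eq_bigr do rewrite -addrA.
  by rewrite affine -xz mul0r addr0; lra.
- have ci : current (ph s) = Some i0 by rewrite E.
  rewrite (lastE _ ci) /block_potential E /= addr0.
  have ii0 := cur _ ci; subst i0.
  have [rg _ _] := I1 _ ci.
  case V : (visits s q) => /=.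
    move: nobs rg; rewrite V; case: (regen s i) => [z|//] /esym /eqP <- _.
    rewrite sum_P H_target.
    have : 0 <= \sum_y P i (xs i) y * gam i y.
      by apply: sumr_ge0 => y _; rewrite mulr_ge0.
    rewrite gam_step /Delta; lra.
  move: nobs rg; rewrite V; case: (regen s i) => [z|//] xz _.
  by rewrite affine -xz mul0r addr0; lra.
Qed.

End RegretPotential.

(** * The potential of a deviation of the samples *)

Section SamplePotential.
Context (R : realType) (K : nat) (N : 'I_K -> nat).
Variables (r : forall i, 'I_(N i) -> R) (L : R).
Variables (P : forall i, 'M[R]_(N i)) (f : forall i, 'I_(N i) -> R).
Arguments f : clear implicits.
Local Notation obs := {i : 'I_K & 'I_(N i)}.
Local Notation mkobs j x := (@Tagged _ j (fun i0 => 'I_(N i0)) x).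
Implicit Types (h : history N) (xs : forall i, 'I_(N i)).
Hypothesis P_sum : forall i x, \sum_y P i x y = 1.
Variables (j : 'I_K) (theta B : R) (w : nat).
Hypothesis w_gt0 : (0 < w)%N.
Let v := mgf (P j) (f j) theta.
Hypothesis v_le : forall z, v w z <= B.

Definition score (q : obs) : R := f (tag q) (tagged q).

Definition within_arm (p : phase K) := if p is Within i then i == j else false.

(** The current state of the chain formed by the concatenated SB2 periods of arm
    [j]. An SB2 period begins with the regenerative state and stops just before
    the next visit to it, so outside SB2 this chain is at the regenerative
    state. *)
Definition virtual_state h xs : option 'I_(N j) :=
  if within_arm (ph (rca_run r h)) then Some (xs j) else regen (rca_run r h) j.

(** The conditional mean of the exponential of [theta] times the sum of the first
    [w] samples of arm [j], if the arm goes on being played, once it has a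
    regenerative state; before that, an upper bound of this mean. *)
Definition sample_potential h xs : R :=
  if virtual_state h xs is Some z
  then expR (theta * \sum_(q <- take w (samples r j h)) score q)
       * v (w - size (samples r j h)) z
  else B.

Lemma regen_none_samples h : rca_history r L h ->
  regen (rca_run r h) j = None -> samples r j h = [::].
Proof.
elim=> // {}h q Hh IH C; rewrite rca_run_rcons samples_rcons.
have [_ _ -> _ _] := rca_stepE r (rca_run r h) q.
have [I1 _ _ _ _] := rca_historyI Hh.
set s := rca_run r h in IH C I1 *.
have [Et|tj] := eqVneq (tag q) j; last first.
  rewrite andbF cats0; case: ifP => // _.
  by rewrite dfwithout //; apply: IH.
case W : (is_within (ph s)); rewrite ?andbF ?andbT.
  move: W C; rewrite /rca_choice -/s; case E : (ph s) => [|//|i] // _ ti.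
  have [] := I1 i; first by rewrite E.
  by rewrite -ti Et => rg _ _ rn; case: rg.
case: (in_sb2 s q) => /=; last by rewrite cats0; apply: IH.
move=> {IH}; subst j; by rewrite dfwithin.
Qed.

Lemma sample_potential_local h q xs xs' : xs (tag q) = xs' (tag q) ->
  sample_potential (rcons h q) xs = sample_potential (rcons h q) xs'.
Proof.
move=> E; rewrite /sample_potential /virtual_state rca_run_rcons.
have [-> _ _ _ _] := rca_stepE r (rca_run r h) q.
suff -> : (if within_arm (next_phase (rca_run r h) q) then Some (xs j)
   else regen (rca_step r (rca_run r h) q) j) =
  (if within_arm (next_phase (rca_run r h) q) then Some (xs' j)
   else regen (rca_step r (rca_run r h) q) j) by [].
case: ifP => //; rewrite /next_phase; case: q E => i x /= E.
do 2 case: ifP => _ //=; by move=> /eqP ij; subst i; rewrite E.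
Qed.

(** In an SB2 slot of [j] this is the recursion of [mgf]; in all other slots the
    samples and the virtual state stay the same. *)
Lemma sample_potential_drift h i xs : rca_history r L h -> rca_choice r L h i ->
  \sum_y P i (xs i) y * sample_potential (rcons h (mkobs i (xs i))) (dfwith xs i y)
  <= sample_potential h xs.
Proof.
move=> Hh C.
have [I1 _ _ _ _] := rca_historyI Hh.
have cur k : current (ph (rca_run r h)) = Some k -> i = k.
  by move: C; rewrite /rca_choice; case: (ph _) => //= ? -> [].
have none := regen_none_samples Hh.
set q := mkobs i (xs i).
have [phE _ rgE _ _] := rca_stepE r (rca_run r h) q.
rewrite /sample_potential /virtual_state.
under eq_bigr do rewrite rca_run_rcons samples_rcons phE rgE.
set s := rca_run r h in I1 cur none phE rgE *.
have cst c : \sum_y P i (xs i) y * c = c by rewrite -mulr_suml P_sum mul1r.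
have [ij|ij] := eqVneq i j; last first.
  have -> : within_arm (ph s) = false.
    by move: cur; case: (ph s) => //= k /(_ _ erefl) <-; apply/negbTE.
  have -> : within_arm (next_phase s q) = false.
    by rewrite /next_phase; case: visits; case: is_within => //=; apply/negbTE.
  have -> : (if in_sb2 s q && ~~ is_within (ph s) then dfwith (regen s) (tag q) (Some (tagged q))
     else regen s) j = regen s j by case: ifP => // _; rewrite dfwithout.
  by rewrite andbF cats0; case: (regen s j) => [z|]; rewrite cst.
move: @q phE rgE; subst i; move=> q phE rgE.
have within_armE : within_arm (ph s) = is_within (ph s).
  by move: cur; case: (ph s) => //= k /(_ _ erefl) ->; rewrite eqxx.
rewrite within_armE.
have nextE : within_arm (next_phase s q) = in_sb2 s q.
  by rewrite /next_phase /in_sb2; case: visits; case: is_within => //=; rewrite ?eqxx.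
rewrite nextE /= ?eqxx andbT.
have rgW : is_within (ph s) -> regen s j <> None.
  move: cur I1; case: (ph s) => //= k /(_ _ erefl) <- /(_ _ erefl) [] //.
have visE : visits s q = if regen s j is Some z then xs j == z else true by [].
under eq_bigr do rewrite dfwithin.
case sb2 : (in_sb2 s q) => /=; last first.
  rewrite cats0; under eq_bigr do rewrite /=.
  move: sb2 rgW visE; rewrite /in_sb2; case: is_within => /=; case: (visits s q) => //= _ rgW;
   case: (regen s j) rgW => [z|] // rgW.
  - by move=> /esym /eqP <-; rewrite cst.
  - by case: rgW.
  - by rewrite cst.
set smp := samples r j h in none *.
have step (z := xs j) : regen s j <> None ->
    \sum_y P j z y * (expR (theta * \sum_(q0 <- take w (smp ++ [:: q])) score q0) *
       v (w - size (smp ++ [:: q])) y) =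
    expR (theta * \sum_(q0 <- take w smp) score q0) * v (w - size smp) z.
  move=> _; rewrite size_cat addn1.
  have [lw|wl] := ltnP (size smp) w; last first.
    rewrite takel_cat //.
    have -> : (w - (size smp).+1 = 0)%N by lia.
    have -> : (w - size smp = 0)%N by lia.
    by rewrite /v /= cst.
  have -> : take w (smp ++ [:: q]) = smp ++ [:: q].
    by rewrite take_oversize // size_cat addn1.
  have -> : take w smp = smp by rewrite take_oversize // ltnW.
  rewrite big_cat /= big_seq1.
  rewrite -[in RHS](subnSK lw) /v /= /score /=.
  under eq_bigr do rewrite mulrCA.
  by rewrite -mulr_sumr mulrA -expRD -mulrDr.
case: ifP => W.
  by rewrite step //; exact: rgW.
move: visE sb2; rewrite /in_sb2 W /= => visE sb2; rewrite sb2 in visE.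
case E : (regen s j) visE step => [z|] visE step.
  by rewrite step // (eqP (esym visE)).
rewrite none // /=.
apply: le_trans (v_le (xs j)).
case: w w_gt0 => // w' _; rewrite /= big_seq1 subn1 /=.
rewrite /v /= mulr_sumr; apply: ler_sum => y _.
by rewrite mulrCA.
Qed.

Definition sample_excess b h : bool :=
  (w <= size (samples r j h))%N && (b <= \sum_(q <- take w (samples r j h)) score q).

(** Markov's inequality for the exponential, pointwise. *)
Lemma sample_potential_excess b h xs : 0 <= theta -> 0 <= B ->
  (forall k z, 0 <= v k z) -> rca_history r L h ->
  (sample_excess b h)%:R <= expR (- (theta * b)) * sample_potential h xs.
Proof.
move=> th0 B0 v0 Hh; rewrite /sample_potential /sample_excess.
case: andP => [[ws eb]|_] /=; last first.
  by case: virtual_state => [z|]; rewrite !mulr_ge0 ?expR_ge0.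
case E : virtual_state => [z|].
  have -> : (w - size (samples r j h) = 0)%N by apply/eqP; rewrite subn_eq0.
  rewrite /v /= mulr1 -expRD -expR0 ler_expR addrC subr_ge0.
  by rewrite ler_wpM2l.
move: E ws; rewrite /virtual_state; case: ifP => // _ /(regen_none_samples Hh) ->.
by rewrite leqNgt w_gt0.
Qed.

End SamplePotential.

(** * Selections of a suboptimal arm *)

(** Convergence by comparison with the telescoping series of [1 / (t (t + 1))]. *)
Lemma beta_partial (R : realType) n : \sum_(1 <= t < n.+1) (t%:R : R) ^- 2 <= beta R.
Proof.
have telesc m : \sum_(0 <= t < m.+1) (t.+1%:R : R) ^- 2 <= 2 - m.+1%:R^-1.
  elim: m => [|m IH]; first by rewrite big_nat1 expr1n invr1; lra.
  rewrite big_nat_recr //=; apply: le_trans (lerD IH (lexx _)) _.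
  have a0 : 0 < m.+1%:R :> R by rewrite ltr0n.
  have -> : m.+2%:R = m.+1%:R + 1 :> R by rewrite -natr1.
  set a := m.+1%:R in a0 *.
  have : 0 <= a^-1 - (a + 1)^-1 - (a + 1) ^- 2.
    have -> : a^-1 - (a + 1)^-1 - (a + 1) ^- 2 = (a * (a + 1) ^+ 2)^-1.
      by field; rewrite !gt_eqF // addr_gt0.
    by rewrite invr_ge0 mulr_ge0 ?exprn_ge0 ?addr_ge0 // ltW.
  move: (a^-1) ((a + 1)^-1) ((a + 1) ^- 2) => u v z; lra.
have nd : nondecreasing_seq (series (fun t : nat => (t.+1%:R : R) ^- 2)).
  by apply: nondecreasing_series => t _ _; rewrite invr_ge0 exprn_ge0.
have cv : cvgn (series (fun t : nat => (t.+1%:R : R) ^- 2)).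
  apply: nondecreasing_is_cvgn => //; exists 2 => _ [m _ <-].
  apply: (@le_trans _ _ (2 - m.+1%:R^-1)); last by rewrite gerBl invr_ge0.
  apply: le_trans (telesc m); rewrite /series /= [leRHS]big_nat_recr //= lerDl.
  by rewrite invr_ge0 exprn_ge0.
have := nondecreasing_cvgn_le nd cv n.
by rewrite /series /= big_add1.
Qed.

Section Selection.
Context (R : realType) (K : nat) (N : 'I_K -> nat).
Variables (r : forall i, 'I_(N i) -> R) (L : R) (mu : 'I_K -> R).
Implicit Types (h : history N).

Lemma samples_take j w h q : (w <= size (samples r j h))%N ->
  take w (samples r j (rcons h q)) = take w (samples r j h).
Proof. by move=> ws; rewrite samples_rcons takel_cat. Qed.

Lemma sample_excess_mono (f : forall i, 'I_(N i) -> R) j w b h q :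
  (sample_excess r f j w b h <= sample_excess r f j w b (rcons h q))%N.
Proof.
rewrite /sample_excess; case ws : (w <= size (samples r j h))%N => //=.
by rewrite samples_take // samples_rcons size_cat (leq_trans ws (leq_addr _ _)).
Qed.

Lemma sample_excess_scale (f : forall i, 'I_(N i) -> R) j w b c h : 0 < c ->
  sample_excess r (fun i x => f i x / c) j w (b / c) h = sample_excess r f j w b h.
Proof.
move=> c0; rewrite /sample_excess /score -mulr_suml ler_pdivrMr //.
by rewrite divfK ?gt_eqF.
Qed.

(** The confidence term in the index of an arm. *)
Definition radius (t w : nat) : R := Num.sqrt (L * ln (t%:R) / w%:R).

Definition excess_above i (t w : nat) h : bool :=
  sample_excess r (fun k x => r x - mu k) i w (w%:R * radius t w) h.

Definition excess_below i (t w : nat) h : bool :=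
  sample_excess r (fun k x => mu k - r x) i w (w%:R * radius t w) h.

(** The usual argument for upper confidence bounds: otherwise
    [mu star < index of star <= index of i < mu i + 2 radius <= mu star]. *)
Lemma selected_excess star i (l n : nat) h :
  mu i < mu star -> 0 <= L -> (0 < l)%N ->
  4 * L * ln (n%:R) / (mu star - mu i) ^+ 2 <= l%:R ->
  rca_history r L h -> is_between (ph (rca_run r h)) ->
  (K <= nblocks (rca_run r h))%N -> rca_choice r L h i ->
  (l <= slots2 (rca_run r h) i)%N -> (size h <= n)%N ->
  let t := sb2_total r h in
  exists w, (0 < w <= t)%N /\ (excess_below star t w h \/ excess_above i t w h).
Proof.
move=> gap L0 l_gt0 l_ge Hh bet nbK C li hn t.
have [_ I2 _ _ _] := rca_historyI Hh.
have pos j : (0 < slots2 (rca_run r h) j)%N by apply: I2; exact: leq_trans (ltn_ord j) nbK.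
have le_t j : (slots2 (rca_run r h) j <= t)%N by rewrite /t /sb2_total (bigD1 j) //= leq_addr.
have index_le : rca_index L (rca_run r h) star <= rca_index L (rca_run r h) i.
  move: C; rewrite /rca_choice; case: (ph _) bet => //= _.
  by rewrite ltnNge nbK /= => /(_ star).
set ws := slots2 (rca_run r h) star in index_le.
set wi := slots2 (rca_run r h) i in index_le.
have [above|nabove] := boolP (excess_above i t wi h).
  by exists wi; rewrite pos le_t; split=> //; right.
have [below|nbelow] := boolP (excess_below star t ws h).
  by exists ws; rewrite pos le_t; split=> //; left.
exfalso.
have n0 (w : nat) : (0 < w)%N -> (w%:R : R) != 0 by rewrite pnatr_eq0 -lt0n.
have lti : rewards2 (rca_run r h) i / wi%:R < mu i + radius t wi.
  move: nabove; rewrite /excess_above /sample_excess /wi slots2_samples leqnn /= -ltNge.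
  rewrite take_size -slots2_samples -/wi rewards2_samples.
  rewrite ltr_pdivrMr ?ltr0n ?pos // mulrDl [radius _ _ * _]mulrC.
  have -> : \sum_(q <- samples r i h) score (fun k x => r x - mu k) q =
     \sum_(q <- samples r i h) r (tagged q) - mu i * wi%:R.
    rewrite sumrB; congr (_ - _); rewrite big_seq.
    rewrite (eq_bigr (fun=> mu i)) => [|q /samples_tag -> //].
    rewrite -big_seq big_const_seq count_predT iter_addr_0 -slots2_samples.
    by rewrite mulr_natr.
  by rewrite ltrBlDl.
have gts : mu star - radius t ws < rewards2 (rca_run r h) star / ws%:R.
  move: nbelow; rewrite /excess_below /sample_excess /ws slots2_samples leqnn /= -ltNge.
  rewrite take_size -slots2_samples -/ws rewards2_samples.
  rewrite ltr_pdivlMr ?ltr0n ?pos // mulrBl [radius _ _ * _]mulrC.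
  have -> : \sum_(q <- samples r star h) score (fun k x => mu k - r x) q =
     mu star * ws%:R - \sum_(q <- samples r star h) r (tagged q).
    rewrite sumrB; congr (_ - _); rewrite big_seq.
    rewrite (eq_bigr (fun=> mu star)) => [|q /samples_tag -> //].
    rewrite -big_seq big_const_seq count_predT iter_addr_0 -slots2_samples.
    by rewrite mulr_natr.
  by rewrite ltrBlDr ltrBlDl.
move: index_le; rewrite /rca_index -/(sb2_total r h) -/t -/ws -/wi.
rewrite -/(radius t ws) -/(radius t wi) => index_le.
have t_gt0 : (0 < t)%N by apply: leq_trans (pos i) (le_t i).
have rad_le : radius t wi <= (mu star - mu i) / 2.
  have d0 : 0 < mu star - mu i by rewrite subr_gt0.
  have -> : (mu star - mu i) / 2 = Num.sqrt (((mu star - mu i) / 2) ^+ 2).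
    by rewrite sqrtr_sqr ger0_norm // divr_ge0 // ltW.
  rewrite ler_wsqrtr //.
  rewrite ler_pdivrMr ?ltr0n ?pos //.
  apply: (@le_trans _ _ (L * ln n%:R)).
    rewrite ler_wpM2l // ler_ln ?posrE ?ltr0n ?ler_nat //.
      exact: leq_trans (sb2_total_size _ _) hn.
    by apply: leq_trans (leq_trans t_gt0 (sb2_total_size _ _)) hn.
  move: l_ge; rewrite ler_pdivrMr ?exprn_gt0 // => l_ge.
  have lw : (l%:R : R) <= wi%:R by rewrite ler_nat.
  have : l%:R * (mu star - mu i) ^+ 2 <= wi%:R * (mu star - mu i) ^+ 2.
    by rewrite ler_wpM2r ?sqr_ge0.
  rewrite expr_div_n; lra.
lra.
Qed.

Definition bad_events star i (t : nat) h : nat :=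
  (\sum_(1 <= w < t.+1) (excess_below star t w h + excess_above i t w h))%N.

Lemma block_count_bad star i (l n : nat) h :
  mu i < mu star -> 0 <= L -> (0 < l)%N ->
  4 * L * ln (n%:R) / (mu star - mu i) ^+ 2 <= l%:R ->
  rca_history r L h -> (size h <= n)%N ->
  (block_count r i h <= l + \sum_(1 <= t < n.+1) bad_events star i t h)%N.
Proof.
move=> gap L0 l_gt0 l_ge; apply: block_count_le => //.
  move=> t h' q; apply: leq_sum => w _.
  by apply: leq_add; apply: sample_excess_mono.
move=> h' Hh' bet nbK C li hn.
have [w [w_in ex]] := selected_excess gap L0 l_gt0 l_ge Hh' bet nbK C li hn.
rewrite /bad_events (bigD1_seq w) ?mem_index_iota ?iota_uniq //=.
by case: ex => ->; rewrite ?addn1 ?addSn.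
Qed.

End Selection.

(** * The bandit problem *)

Section Bandit.
Context (R : realType) (d : measure_display) (T : measurableType d).
Variable Pr : probability T R.
Context (K : nat) (N : 'I_K -> nat).
Variables (P : forall i, 'M[R]_(N i)) (p r : forall i, 'I_(N i) -> R).
Arguments p : clear implicits.
Arguments r : clear implicits.
Variables (X : forall i, nat -> T -> 'I_(N i)) (star : 'I_K) (L : R).
Variable alpha : T -> policy N.
Hypothesis N_gt1 : forall i, (1 < N i)%N.
Hypothesis P_stochastic : forall i, stochastic (P i).
Hypothesis P_irreducible : forall i, irreducible (P i).
Hypothesis p_stationary : forall i, stationary (P i) (p i).
Hypothesis symm_irreducible : forall i, irreducible (mult_symm (P i) (p i)).
Hypothesis r_gt0 : forall i x, 0 < r i x.
Hypothesis star_best : forall i, i != star -> mean_reward p r i < mean_reward p r star.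
Arguments P_stochastic : clear implicits.
Arguments P_irreducible : clear implicits.
Arguments p_stationary : clear implicits.
Arguments symm_irreducible : clear implicits.
Arguments r_gt0 : clear implicits.
Hypothesis X_chain : forall i, markov_chain Pr (P i) (X i).
Hypothesis alpha_rca : forall w, is_rca r L (alpha w).
Hypothesis alpha_meas : forall h i, measurable [set w | alpha w h = i].
Hypothesis indep : mutually_independent Pr (sources X alpha).
Hypothesis L_ge : 112 * (S_max N)%:R ^+ 2 * r_max r ^+ 2 * phat_max p ^+ 2
            / gap_min P p <= L.

Local Notation mkobs j x := (@Tagged _ j (fun i0 => 'I_(N i0)) x).
Local Notation mean := (slot_mean Pr X alpha).
Local Notation mu := (mean_reward p r).
Implicit Types (h : history N) (xs : forall i, 'I_(N i)).

Let P_ge0 i x y : 0 <= P i x y. Proof. by case: (P_stochastic i). Qed.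
Let P_sum i x : \sum_y P i x y = 1. Proof. by case: (P_stochastic i). Qed.
Let p_sum i : \sum_x p i x = 1. Proof. by case: (p_stationary i). Qed.
Let p_gt0 i x : 0 < p i x.
Proof. exact: (stationary_gt0 (P_stochastic i) (P_irreducible i) (p_stationary i)). Qed.
Let p_ge0 i x : 0 <= p i x. Proof. exact: ltW. Qed.

(** * Expectations along a run of the algorithm *)

Lemma hist_rca t w : rca_history r L (hist X alpha t w).
Proof.
elim: t => [|t IH]; first exact: rca_history_nil.
by rewrite histS; apply: rca_history_rcons => //; exact: alpha_rca.
Qed.

Lemma mean_le_rca t G H :
  (forall h xs i, size h = t -> rca_history r L h -> rca_choice r L h i ->
     G h xs i <= H h xs i) -> mean t G <= mean t H.
Proof.
move=> GH; apply: (slot_mean_le X_chain alpha_meas) => w; apply: GH.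
- exact: size_hist.
- exact: hist_rca.
- exact: alpha_rca.
Qed.

Lemma mean_sum (I : Type) (s : seq I) t (G : I -> history N -> (forall i, 'I_(N i)) -> 'I_K -> R) :
  mean t (fun h xs i => \sum_(k <- s) G k h xs i) = \sum_(k <- s) mean t (G k).
Proof.
elim: s => [|k s IH].
  rewrite big_nil -[RHS](slot_mean_cst Pr X alpha t 0); congr (slot_mean _ _ _ _ _).
  by apply/funext => h; apply/funext => xs; apply/funext => i; rewrite big_nil.
rewrite big_cons -IH -(slot_meanD X_chain alpha_meas); congr (slot_mean _ _ _ _ _).
by apply/funext => h; apply/funext => xs; apply/funext => i; rewrite big_cons.
Qed.

Lemma mean_supermartingale (G : history N -> (forall i, 'I_(N i)) -> R) n :
  (forall h q xs xs', xs (tag q) = xs' (tag q) -> G (rcons h q) xs = G (rcons h q) xs') ->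
  (forall h i xs, rca_history r L h -> rca_choice r L h i ->
     \sum_y P i (xs i) y * G (rcons h (mkobs i (xs i))) (dfwith xs i y) <= G h xs) ->
  mean n (fun h xs _ => G h xs) <= mean 0 (fun h xs _ => G h xs).
Proof.
move=> loc drift; elim: n => // n IH; apply: le_trans IH.
rewrite (slot_mean_step X_chain alpha_meas indep) //.
by apply: mean_le_rca => h xs i _; exact: drift.
Qed.

(** * Extremal parameters *)

Lemma p_min_le i x : p_min p <= p i x.
Proof. by apply: le_trans (bigmin_le _ i _) _; exact: bigmin_le. Qed.

Lemma p_min_gt0 : 0 < p_min p.
Proof. by do 2 apply: lt_bigmin => // ? _. Qed.

Lemma min_prob_gt0 i : 0 < min_prob (p i).
Proof. by apply: lt_bigmin. Qed.

Lemma gap_min_gt0 : 0 < gap_min P p.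
Proof.
apply: lt_bigmin => // i _; apply: (eigen_gap_gt0 (N_gt1 i)) => //.
Qed.

Lemma gap_min_le1 : gap_min P p <= 1.
Proof. exact: bigmin_le_id. Qed.

Lemma r_le_max i x : r i x <= r_max r.
Proof. by apply: le_trans (le_bigmax _ _ i); exact: (le_bigmax _ (r i)). Qed.

Lemma r_max_gt0 : 0 < r_max r.
Proof.
have x : 'I_(N star) by exact: Ordinal (ltnW (N_gt1 star)).
exact: lt_le_trans (r_gt0 star x) (r_le_max x).
Qed.

Lemma mu_gt0 i : 0 < mu i.
Proof.
rewrite /mean_reward; have x : 'I_(N i) by exact: Ordinal (ltnW (N_gt1 i)).
rewrite (bigD1 x) //= ltr_pwDl ?mulr_gt0 // sumr_ge0 // => y _.
by rewrite mulr_ge0 // ltW.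
Qed.

Lemma mu_le_max i : mu i <= r_max r.
Proof.
rewrite -[leRHS]mulr1 -(p_sum i) mulr_sumr; apply: ler_sum => x _.
by rewrite ler_wpM2r // r_le_max.
Qed.

(** [S_max >= 2] and [phat_max >= 1/2]. *)
Lemma L_ge_reduced : 112 * r_max r ^+ 2 / gap_min P p <= L.
Proof.
apply: le_trans L_ge; rewrite ler_wpM2r ?invr_ge0 ?(ltW gap_min_gt0) //.
have S2 : 2 <= (S_max N)%:R :> R.
  rewrite (ler_nat R 2); apply: leq_trans (N_gt1 star) _.
  exact: (leq_bigmax star).
have x : 'I_(N star) by exact: Ordinal (ltnW (N_gt1 star)).
have phi : 2^-1 <= phat_max p.
  apply: le_trans (le_bigmax _ _ star); apply: le_trans (le_bigmax _ _ x).
  by rewrite le_max; have [?|?] := lerP (2^-1) (p star x); rewrite //=; lra.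
have Sphi : 1 <= ((S_max N)%:R * phat_max p) ^+ 2.
  apply: exprn_ege1; rewrite -[leLHS](@divff _ 2) // ler_pM //.
have -> : 112 * (S_max N)%:R ^+ 2 * r_max r ^+ 2 * phat_max p ^+ 2 =
   112 * r_max r ^+ 2 * ((S_max N)%:R * phat_max p) ^+ 2 by ring.
by rewrite ler_peMr // mulr_ge0 // sqr_ge0.
Qed.

Lemma L_gt0 : 0 < L.
Proof.
apply: lt_le_trans L_ge_reduced; rewrite divr_gt0 ?gap_min_gt0 // mulr_gt0 //.
by rewrite exprn_gt0 // r_max_gt0.
Qed.

(** * Deviations of the sample means *)

Section Tail.
Variables (f : forall i, 'I_(N i) -> R) (j : 'I_K).
Arguments f : clear implicits.
Hypothesis f_le1 : forall x, `|f j x| <= 1.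
Hypothesis f_mean : \sum_x f j x * p j x = 0.

(** For [g > 1] the event is impossible, as the scores are at most 1; otherwise
    this is the Chernoff bound along the run. *)
Lemma sample_excess_tail n w g : (0 < w)%N -> 0 <= g ->
  mean n (fun h _ _ => (sample_excess r f j w (w%:R * g) h)%:R) <=
  2 / p_min p * expR (- (g ^+ 2 * gap_min P p / 20) *+ w).
Proof.
move=> w0 g0.
have rhs0 : 0 <= 2 / p_min p * expR (- (g ^+ 2 * gap_min P p / 20) *+ w).
  by rewrite mulr_ge0 ?expR_ge0 // divr_ge0 // ltW // p_min_gt0.
have [g1|g1] := leP g 1; last first.
  apply: le_trans rhs0.
  rewrite -(slot_mean_cst Pr X alpha n 0); apply: mean_le_rca => h _ i _ Hh _.
  rewrite lern0 eqb0 /sample_excess; apply/negP => /andP[ws].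
  apply/negP; rewrite -ltNge.
  apply: (@le_lt_trans _ _ w%:R); last by rewrite ltr_pMr // ltr0n.
  rewrite -[in leRHS](size_takel ws) -sum1_size natr_sum.
  rewrite big_seq [leRHS]big_seq; apply: ler_sum => q qs.
  rewrite /score; case: q qs => k x /mem_take /samples_tag /= kj; subst k.
  by apply: le_trans (f_le1 x); exact: ler_norm.
set eps := gap_min P p in rhs0 *.
have eps0 : 0 < eps by exact: gap_min_gt0.
pose theta := g * eps / 12.
pose B := expR (theta * (w%:R * g)) * (2 / p_min p * expR (- (g ^+ 2 * eps / 20) *+ w)).
have B0 : 0 <= B by rewrite mulr_ge0 ?expR_ge0.
have theta0 : 0 <= theta by rewrite divr_ge0 // mulr_ge0 // ltW.
have contr := @symm_gap_contraction R (N j) (P j) (p j) (N_gt1 j) (p_gt0 (i := j))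
  (P_stochastic j) (p_stationary j) eps (symm_irreducible j) (bigmin_le _ j _).
have vB z : mgf (P j) (f j) theta w z <= B.
  have := @mgf_chernoff R (N j) (P j) (p j) (f j) eps g (p_gt0 (i := j))
    (P_stochastic j) (p_stationary j) eps0 gap_min_le1 g0 g1 f_le1 f_mean contr w z.
  rewrite -/theta mulNrn expRN ler_pdivrMl ?expR_gt0 // => H.
  apply: le_trans H _; rewrite /B.
  have -> : theta * g *+ w = theta * (w%:R * g) by rewrite -mulr_natr; ring.
  rewrite ler_wpM2l ?expR_ge0 // ler_wpM2r ?expR_ge0 // ler_wpM2l //.
  by rewrite lef_pV2 ?posrE ?p_min_gt0 // p_min_le.
pose V := sample_potential r P f j theta B w.
have le1 : mean n (fun h _ _ => (sample_excess r f j w (w%:R * g) h)%:R) <=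
    mean n (fun h xs _ => expR (- (theta * (w%:R * g))) * V h xs).
  apply: mean_le_rca => h xs i _ Hh _; apply: sample_potential_excess (Hh) => //.
  by move=> k z; apply: mgf_ge0.
apply: le_trans le1 _; rewrite (slot_meanZ X_chain alpha_meas).
rewrite expRN ler_pdivrMl ?expR_gt0 // -/B.
have -> : B = mean 0 (fun h xs _ => V h xs).
  rewrite -[LHS](slot_mean_cst Pr X alpha 0); apply/eqP; rewrite eq_le.
  have V0 h xs : size h = 0%N -> V h xs = B.
    by move=> /size0nil ->; rewrite /V /sample_potential /virtual_state.
  by apply/andP; split; apply: mean_le_rca => h xs i h0 _ _; rewrite V0.
apply: mean_supermartingale.
  by move=> h q xs xs'; exact: sample_potential_local.
by move=> h i xs Hh C; exact: sample_potential_drift Hh C.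
Qed.

End Tail.

Lemma radius_tail t w : (0 < t)%N -> (0 < w)%N ->
  expR (- ((radius L t w / r_max r) ^+ 2 * gap_min P p / 20) *+ w) <= (t%:R : R) ^- 3.
Proof.
move=> t0 w0; have e0 := gap_min_gt0; have r0 := r_max_gt0.
have lt0 : 0 <= ln (t%:R : R) by rewrite ln_ge0 // ler1n.
have w0' : 0 < w%:R :> R by rewrite ltr0n.
have -> : (t%:R : R) ^- 3 = expR (- (ln t%:R *+ 3)).
  by rewrite expRN -[ln _ *+ 3]mulr_natl expRM_natl lnK // posrE ltr0n.
rewrite ler_expR mulNrn lerN2 /radius expr_div_n sqr_sqrtr; last first.
  by rewrite divr_ge0 ?ler0n // mulr_ge0 // ltW // L_gt0.
have -> : L * ln t%:R / w%:R / r_max r ^+ 2 * gap_min P p / 20 *+ w =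
   ln t%:R * (L * gap_min P p / r_max r ^+ 2 / 20).
  by rewrite -mulr_natr; field; rewrite !gt_eqF.
rewrite -[leLHS]mulr_natr ler_wpM2l // ler_pdivlMr // ler_pdivlMr ?exprn_gt0 //.
have := L_ge_reduced; rewrite ler_pdivrMr //.
have := sqr_ge0 (r_max r); lra.
Qed.

(** * Number of blocks of a suboptimal arm *)

Lemma mean_excess_tail (f : forall i, 'I_(N i) -> R) j n t w :
  (forall x, `|f j x| <= r_max r) -> \sum_x f j x * p j x = 0 ->
  (0 < t)%N -> (0 < w)%N ->
  mean n (fun h _ _ => (sample_excess r f j w (w%:R * radius L t w) h)%:R) <=
  2 / p_min p * (t%:R : R) ^- 3.
Proof.
move=> f_le f0 t0 w0; have r0 := r_max_gt0.
pose f1 i (x : 'I_(N i)) := f i x / r_max r.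
have -> : (fun h (_ : forall i, 'I_(N i)) (_ : 'I_K) =>
      (sample_excess r f j w (w%:R * radius L t w) h)%:R : R) =
    (fun h _ _ => (sample_excess r f1 j w (w%:R * (radius L t w / r_max r)) h)%:R).
  apply/funext => h; apply/funext => _; apply/funext => _.
  by rewrite mulrA sample_excess_scale.
apply: le_trans (sample_excess_tail _ _ _ w0 _) _.
- by move=> x; rewrite /f1 normrM normfV (gtr0_norm r0) ler_pdivrMr // mul1r.
- by rewrite /f1; under eq_bigr do rewrite mulrAC; rewrite -mulr_suml f0 mul0r.
- by rewrite divr_ge0 ?sqrtr_ge0 // ltW.
- by rewrite ler_wpM2l ?radius_tail // divr_ge0 // ltW // p_min_gt0.
Qed.

(** The integer [l] exceeds [c] by at most 1, which is the constant 1 in [C_], and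
    the union bound gives [4 beta / p_min], where [4 <= N i + N star]. *)
Lemma mean_block_count_le i n : i != star ->
  mean n (fun h _ _ => (block_count r i h)%:R) <=
  4 * L * ln (n%:R) / (mu star - mu i) ^+ 2 + C_ p star i.
Proof.
move=> ist; have gap := star_best ist.
have d0 : 0 < mu star - mu i by rewrite subr_gt0.
set c := 4 * L * ln n%:R / _.
have c0 : 0 <= c.
  rewrite divr_ge0 ?sqr_ge0 // mulr_ge0 ?mulr_ge0 ?(ltW L_gt0) //.
  by case: n @c => [|n] c; [rewrite ln0|rewrite ln_ge0 // ler1n].
pose l := (Num.truncn c).+1.
have lc : c <= l%:R by exact: ltW (truncnS_gt c).
have l1 : l%:R <= c + 1 by rewrite /l -natr1 lerD2r truncn_le.
have dev j (x : 'I_(N j)) : `|mu j - r j x| <= r_max r.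
  rewrite ler_norml; have := mu_gt0 j; have := mu_le_max j.
  have := r_le_max x; have := r_gt0 j x; lra.
have mean0 j : \sum_x (mu j - r j x) * p j x = 0.
  under eq_bigr do rewrite mulrBl.
  by rewrite sumrB -mulr_sumr p_sum mulr1 subrr.
pose u t : R := \sum_(1 <= w < t.+1) (2 / p_min p * t%:R ^- 3 + 2 / p_min p * t%:R ^- 3).
apply: (@le_trans _ _ (l%:R + \sum_(1 <= t < n.+1) u t)).
  apply: (@le_trans _ _ (mean n (fun h _ _ => l%:R + \sum_(1 <= t < n.+1)
      \sum_(1 <= w < t.+1) ((excess_below r L mu star t w h)%:R
                            + (excess_above r L mu i t w h)%:R)))).
    apply: mean_le_rca => h _ _ sh Hh _.
    have := @block_count_bad _ _ _ r L mu star i l n h gap (ltW L_gt0) (ltn0Sn _) lc Hh.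
    rewrite sh => /(_ (leqnn n)); rewrite -(ler_nat R) natrD natr_sum => /le_trans; apply.
    rewrite lerD2l; apply: ler_sum => t _.
    by rewrite natr_sum; apply: ler_sum => w _; rewrite natrD.
  rewrite (slot_meanD X_chain alpha_meas) slot_mean_cst lerD2l mean_sum.
  rewrite big_nat [leRHS]big_nat; apply: ler_sum => t /andP[t0 _].
  rewrite mean_sum /u big_nat [leRHS]big_nat; apply: ler_sum => w /andP[w0 _].
  rewrite (slot_meanD X_chain alpha_meas); apply: lerD.
    exact: mean_excess_tail.
  apply: mean_excess_tail => //.
    by move=> x; rewrite distrC; exact: dev.
  under eq_bigr do rewrite -opprB mulNr.
  by rewrite sumrN mean0 oppr0.
have uE t : (0 < t)%N -> u t = 4 / p_min p * (t%:R : R) ^- 2.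
  move=> t0; rewrite /u sumr_const_nat subSS subn0 -[LHS]mulr_natr.
  by field; rewrite pnatr_eq0 -lt0n t0 gt_eqF // p_min_gt0.
rewrite big_nat; under eq_bigr => t /andP[t0 _] do rewrite uE //.
rewrite -big_nat -mulr_sumr.
have NN : 4 <= (N i + N star)%:R :> R.
  by rewrite (ler_nat R 4); have := N_gt1 i; have := N_gt1 star; lia.
have b := beta_partial R n.
have s0 : 0 <= \sum_(1 <= t < n.+1) (t%:R : R) ^- 2.
  by apply: sumr_ge0 => t _; rewrite invr_ge0 exprn_ge0.
have : 4 / p_min p * \sum_(1 <= t < n.+1) (t%:R : R) ^- 2 <=
    (N i + N star)%:R * beta R / p_min p.
  rewrite mulrAC ler_wpM2r ?invr_ge0 ?(ltW p_min_gt0) //.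
  by apply: ler_pM.
rewrite /C_; lra.
Qed.

(** * Regret *)

Local Notation M := (fun i => max_hit (P i)).
Local Notation cost := (block_cost star mu M (fun i => (min_prob (p i))^-1)).

(** The process [G] adds to the potential the regret accumulated so far and
    subtracts the costs of the blocks; its expectation decreases from the initial
    reserve [mu star * M star], and the final potential is nonnegative. *)
Lemma regret_le_blocks n :
  n%:R * mu star - mean n (fun h _ _ => \sum_(q <- h) r (tag q) (tagged q)) <=
  mu star * M star + \sum_i cost i * mean n (fun h _ _ => (block_count r i h)%:R).
Proof.
have mu_le i : mu i <= mu star.
  by have [->//|/star_best/ltW] := eqVneq i star.
pose pois i := cid (poisson_solution (P_stochastic i) (P_irreducible i)
  (p_stationary i) (fun x => ltW (r_gt0 i x))).
pose gam i := sval (pois i).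
have gamP i : (forall x, 0 <= gam i x <= mu i * M i) /\
    (forall x, \sum_y P i x y * gam i y = gam i x - mu i + r i x) := svalP (pois i).
have gam_ge0 i x : 0 <= gam i x by have /andP[] := (gamP i).1 x.
have gam_le i x : gam i x <= mu i * M i by have /andP[] := (gamP i).1 x.
pose H i := hit_time (P i).
have H_ge0 i z x : 0 <= H i z x by exact: hit_time_ge0.
pose Phi := regret_potential r p star mu M gam H.
have Phi_ge0 h xs : 0 <= Phi h xs by exact: regret_potential_ge0.
pose G h xs : R := (size h)%:R * mu star - \sum_(q <- h) r (tag q) (tagged q)
  - \sum_i cost i * (block_count r i h)%:R + Phi h xs.
have supG : mean n (fun h xs _ => G h xs) <= mean 0 (fun h xs _ => G h xs).
  apply: mean_supermartingale.
    move=> h q xs xs' E; rewrite /G; congr (_ + _).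
    exact: (@regret_potential_local _ _ _ r p star mu M gam H h q).
  move=> h i xs Hh C.
  have drift := @regret_potential_drift _ _ _ r L P p star mu M
    (fun i => (min_prob (p i))^-1) gam H P_ge0 P_sum mu_le p_gt0.
  have {}drift := drift _ gam_ge0 gam_le (fun i => (gamP i).2) H_ge0
     _ _ _ h i xs Hh C.
  have {}drift : mu star - r i (xs i) +
     \sum_y P i (xs i) y * Phi (rcons h (mkobs i (xs i))) (dfwith xs i y) <=
     Phi h xs + (if is_between (ph (rca_run r h)) then cost i else 0).
    apply: drift.
    - by move=> k x; rewrite lef_pV2 ?posrE ?min_prob_gt0 //; exact: bigmin_le.
    - by move=> k z x; exact: hit_time_le.
    - by move=> k z; exact: hit_time_target.
    - by move=> k z x; exact: hit_time_step.
  rewrite /G; under eq_bigr do rewrite mulrDr.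
  rewrite big_split /= -mulr_suml P_sum mul1r size_rcons -natr1 -cats1 big_cat big_seq1 /=.
  have -> : \sum_k cost k * (block_count r k (h ++ [:: mkobs i (xs i)]))%:R =
      \sum_k cost k * (block_count r k h)%:R +
      (if is_between (ph (rca_run r h)) then cost i else 0).
    rewrite cats1; under eq_bigr do rewrite block_count_rcons natrD mulrDr.
    rewrite big_split /=; congr (_ + _); rewrite (bigD1 i) //= eqxx andbT big1 ?addr0.
      by case: ifP; rewrite ?mulr1 ?mulr0.
    by move=> k ki; rewrite eq_sym (negPf ki) andbF mulr0.
  rewrite cats1; lra.
have G0 : mean 0 (fun h xs _ => G h xs) <= mu star * M star.
  rewrite -[leRHS](slot_mean_cst Pr X alpha 0); apply: mean_le_rca => h xs _ /size0nil -> _ _.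
  rewrite /G mul0r big_nil big1 ?subrr ?add0r => [|i _]; last by rewrite mulr0.
  by rewrite /Phi /regret_potential /= addr0.
have cmp : n%:R * mu star - mean n (fun h _ _ => \sum_(q <- h) r (tag q) (tagged q))
    - \sum_i cost i * mean n (fun h _ _ => (block_count r i h)%:R)
    <= mean n (fun h xs _ => G h xs).
  have -> : \sum_i cost i * mean n (fun h _ _ => (block_count r i h)%:R) =
     mean n (fun h _ _ => \sum_i cost i * (block_count r i h)%:R).
    by rewrite mean_sum; apply: eq_bigr => i _; rewrite -(slot_meanZ X_chain alpha_meas).
  rewrite -addrA -opprD -(slot_meanD X_chain alpha_meas) lerBlDr.
  rewrite -(slot_meanD X_chain alpha_meas) -[leLHS](slot_mean_cst Pr X alpha n).
  apply: mean_le_rca => h xs _ sh _ _; rewrite /G sh; have := Phi_ge0 h xs; lra.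
rewrite addrC -lerBlDl; have := le_trans cmp (le_trans supG G0); lra.
Qed.

Lemma total_reward_hist n w :
  total_reward r (alpha w) (fun i t => X i t w) n =
  \sum_(q <- hist X alpha n w) r (tag q) (tagged q).
Proof.
rewrite /total_reward; elim: n => [|n IH]; first by rewrite big_ord0 big_nil.
by rewrite big_ord_recr IH histS -cats1 big_cat big_seq1.
Qed.

(** Strictness comes from [F_], which exceeds the reserve [mu star * M star]. *)
Lemma regret_lt n : (0 < n)%N ->
  n%:R * mu star - mean n (fun h _ _ => \sum_(q <- h) r (tag q) (tagged q)) <
  regret_bound P p r L star n.
Proof.
move=> n0; apply: le_lt_trans (regret_le_blocks n) _.
have M_ge0 i : 0 <= max_hit (P i) by exact: bigmax_ge_id.
have F_gt : mu star * M star < F_ P p r star.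
  rewrite /F_ ltr_pM2l ?mu_gt0 //.
  have : M star <= hit_max P by exact: (le_bigmax _ (fun i => max_hit (P i))).
  have : 0 < (p_min p)^-1 by rewrite invr_gt0 p_min_gt0.
  by move: (p_min p)^-1 => u /=; lra.
rewrite /regret_bound addrC; apply: ler_ltD (F_gt).
rewrite mulr_sumr -big_split /= [leRHS]big_mkcond /=.
apply: ler_sum => i _; rewrite /block_cost.
have [->|ist] := eqVneq i star; first by rewrite ltxx mul0r.
have gap := star_best ist; rewrite gap.
have d0 : 0 < mu star - mu i by rewrite subr_gt0.
have E0 : 0 <= mu i * M i + mu star * M star.
  by rewrite addr_ge0 // mulr_ge0 // ltW // mu_gt0.
have D0 : 0 <= D_ P p i.
  by rewrite /D_ addr_ge0 // addr_ge0 // invr_ge0 ltW // min_prob_gt0.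
have EE : mu i * M i + mu star * M star <= E_ P p r star i.
  by rewrite /E_ lerD2r ler_wpM2l ?(ltW (mu_gt0 i)) // lerDr.
have -> : 4 * L * ln n%:R * ((mu star - mu i)^-1 *
    (D_ P p i + E_ P p r star i / (mu star - mu i))) +
    C_ p star i * ((mu star - mu i) * D_ P p i + E_ P p r star i) =
    ((mu star - mu i) * D_ P p i + E_ P p r star i) *
    (4 * L * ln n%:R / (mu star - mu i) ^+ 2 + C_ p star i).
  by field; rewrite gt_eqF.
apply: ler_pM.
- by rewrite -addrA addr_ge0 // mulr_ge0 // ltW.
- rewrite -(slot_mean_cst Pr X alpha n 0); apply: mean_le_rca => h _ _ _ _ _.
  exact: ler0n.
- by rewrite -addrA lerD2l.
- exact: mean_block_count_le.
Qed.

End Bandit.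

Theorem theorem2 (R : realType) (d : measure_display) (T : measurableType d)
  (Pr : probability T R)
  (K : nat) (N : 'I_K -> nat) (P : forall i, 'M[R]_(N i))
  (p r : forall i, 'I_(N i) -> R)
  (X : forall i, nat -> T -> 'I_(N i))
  (star : 'I_K) (L : R) (alpha : T -> policy N)
  (N_gt1 : forall i, (1 < N i)%N)
  (P_stochastic : forall i, stochastic (P i))
  (P_irreducible : forall i, irreducible (P i))
  (P_aperiodic : forall i, aperiodic (P i))
  (p_stationary : forall i, stationary (P i) (p i))
  (symm_irreducible : forall i, irreducible (mult_symm (P i) (p i)))
  (r_gt0 : forall i x, 0 < r i x)
  (star_best : forall i, i != star -> mean_reward p r i < mean_reward p r star)
  (X_chain : forall i, markov_chain Pr (P i) (X i))
  (alpha_rca : forall w, is_rca r L (alpha w))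
  (alpha_meas : forall h i, measurable [set w | alpha w h = i])
  (indep : mutually_independent Pr (sources X alpha))
  (L_ge : 112 * (S_max N)%:R ^+ 2 * r_max r ^+ 2 * phat_max p ^+ 2
            / gap_min P p <= L)
  (n : nat) (n_gt0 : (0 < n)%N) :
  (regret r Pr (mean_reward p r star) X alpha n
     < (regret_bound P p r L star n)%:E)%E.
Proof.
rewrite /regret.
under eq_fun do rewrite total_reward_hist.
rewrite (slot_expectation X_chain alpha_meas n
  (fun h _ _ => \sum_(q <- h) r (tag q) (tagged q))) -EFinB lte_fin.
exact: regret_lt.
Qed.
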